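(* Let $V$ be a weak quantum vertex algebra with a constant $\mathcal{S}$-map, let $(W,Y_W)$ be any $\phi$-coordinated $V$-module and let $n\in\mathbb{N}$. Set $$\widetilde{\Omega}_{n}(W)=\{ w\in W\ |\ v_{[m]}w=0\ \text{ for all } v\in V,\ m\ge n+1\}.$$ Then $\widetilde{\Omega}_{n}(W)$ is an $\widetilde{A}_{n}(V)$-module with (the class of) $v$ acting as $v_{[0]}$ for $v\in V$. Furthermore, if $W=\bigoplus_{m\in\mathbb{N}}W[m]$ is an irreducible $\mathbb{N}$-graded $\phi$-coordinated $V$-module with $W[0]\neq 0$, then $\widetilde{\Omega}_{0}(W)=W[0]$ and $W[0]$ is an irreducible $\widetilde{A}(V)$-module, where $\widetilde{A}(V)=\widetilde{A}_0(V)$.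
   Context: All vector spaces are over $\mathbb{C}$; $\mathbb{N}$ is the set of nonnegative integers; $\delta(x)=\sum_{n\in\mathbb{Z}}x^n$; binomial expressions $(x_1\pm x_2)^n$ are expanded in nonnegative powers of the second variable. A weak quantum vertex algebra with a constant $\mathcal{S}$-map is a vector space $V$ with a linear map $Y(\cdot,x):V\to \mathrm{Hom}(V,V((x)))$, $Y(v,x)=\sum_{n\in\mathbb{Z}}v_nx^{-n-1}$, and a vector $\mathbf{1}\in V$ such that $Y(\mathbf{1},x)v=v$, $Y(v,x)\mathbf{1}\in V[[x]]$, $\lim_{x\to0}Y(v,x)\mathbf{1}=v$ for $v\in V$, and for any $u,v\in V$ there exist finitely many $u^{(i)},v^{(i)}\in V$ $(1\le i\le r)$ with $$x_0^{-1}\delta\left(\tfrac{x_1-x_2}{x_0}\right)Y(u,x_1)Y(v,x_2)-x_0^{-1}\delta\left(\tfrac{x_2-x_1}{-x_0}\right)\sum_{i=1}^{r}Y(v^{(i)},x_2)Y(u^{(i)},x_1)=x_2^{-1}\delta\left(\tfrac{x_1-x_0}{x_2}\right)Y(Y(u,x_0)v,x_2).$$ The operator $\mathcal{D}$ on $V$ is $\mathcal{D}v=v_{-2}\mathbf{1}$. A $\phi$-coordinated $V$-module (for $\phi(x,z)=xe^z$) is a vector space $W$ with a linear map $Y_W(\cdot,x):V\to(\mathrm{End}\,W)[[x,x^{-1}]]$, $Y_W(v,x)=\sum_{n\in\mathbb{Z}}v_{[n]}x^{-n}$, such that $Y_W(v,x)w\in W((x))$ for $v\in V,w\in W$, $Y_W(\mathbf{1},x)=1_W$,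 and for any $u,v\in V$ there is $k\in\mathbb{N}$ with $(x_1-x_2)^kY_W(u,x_1)Y_W(v,x_2)\in\mathrm{Hom}(W,W((x_1,x_2)))$, where $W((x_1,x_2))=W[[x_1,x_2]][x_1^{-1},x_2^{-1}]$, and $$(e^{x_0}-1)^kY_W(Y(u,x_0)v,x_2)=\left((x_1/x_2-1)^kY_W(u,x_1)Y_W(v,x_2)\right)|_{x_1=x_2e^{x_0}}.$$ An $\mathbb{N}$-graded $\phi$-coordinated $V$-module is a $\phi$-coordinated $V$-module $W$ with a grading $W=\bigoplus_{n\in\mathbb{N}}W[n]$ such that $v_{[m]}W[n]\subset W[n-m]$ for $v\in V$, $m\in\mathbb{Z}$, $n\in\mathbb{N}$ (with $W[p]=0$ for $p<0$). It is irreducible if it is nonzero and has no graded submodules other than $0$ and itself. For $n\in\mathbb{N}$ set, in $\mathbb{C}((x))$, $$f_n(x)=\sum_{i=0}^n\binom{-n-1}{i}\frac{e^{(n+1)x}}{(e^x-1)^{i+n+1}},\qquad u\tilde{*}_nv=\mathrm{Res}_xf_n(x)Y(u,x)v,\qquad u\tilde{\circ}_nv=\mathrm{Res}_x\frac{e^{(n+1)x}}{(e^x-1)^{2n+2}}Y(u,x)v .$$ Let $\widetilde{O}_n(V)$ be the linear span of $\mathcal{D}V$ and all $u\tilde{\circ}_nv$ $(u,v\in V)$. Then $\widetilde{A}_n(V)=V/\widetilde{O}_n(V)$, an associative algebra with product induced by $\tilde{*}_n$. *)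

(* Defs.v *)
From HB Require Import structures.
From mathcomp Require Import all_boot all_order all_algebra.
From mathcomp Require Import generic_quotient ring_quotient.
From mathcomp Require Import boolp classical_sets functions cardinality fsbigop.
From mathcomp Require Import finmap reals complex zify.

Set Implicit Arguments.
Unset Strict Implicit.
Unset Printing Implicit Defensive.

Import Order.TTheory GRing.Theory Num.Theory.

Local Open Scope classical_set_scope.
Local Open Scope quotient_scope.
Local Open Scope ring_scope.

Section Subspaces.
Variables (F : fieldType) (M : lmodType F).

Inductive subspace_of (U : submodClosed M) : predArgType :=
  Subspace x & x \in U.

Section Sub.
Variable U : submodClosed M.
Definition subspace_val (x : subspace_of U) : M := let: Subspace y _ := x in y.
HB.instance Definition _ := [isSub of subspace_of U for subspace_val].
HB.instance Definition _ := [Choice of subspace_of U by <:].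
HB.instance Definition _ := [SubChoice_isSubLmodule of subspace_of U by <:].
End Sub.

Definition lspan (S : set M) : {pred M} := fun x =>
  `[< exists (r : nat) (a : 'I_r -> F) (s : 'I_r -> M),
        (forall i, S (s i)) /\ x = \sum_(i < r) a i *: s i >].

Lemma lspanP S x :
  reflect (exists (r : nat) (a : 'I_r -> F) (s : 'I_r -> M),
             (forall i, S (s i)) /\ x = \sum_(i < r) a i *: s i)
          (x \in lspan S).
Proof. exact: asboolP. Qed.

Lemma lspan_submod_closed S : submod_closed (lspan S).
Proof.
split=> [|c x y /lspanP[p [a [s [Ss ->]]]] /lspanP[q [b [t [St ->]]]]].
  apply/lspanP; exists 0%N, (fun=> 0), (fun=> 0).
  by split=> [[]//|]; rewrite big_ord0.
apply/lspanP; exists (p + q)%N.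
exists (fun k => match fintype.split k with inl i => c * a i | inr j => b j end).
exists (fun k => match fintype.split k with inl i => s i | inr j => t j end).
split=> [k|]; first by case: (fintype.split k).
rewrite big_split_ord scaler_sumr /=; congr (_ + _); apply: eq_bigr => i _.
  by rewrite -[lshift _ _]/(unsplit (inl i)) unsplitK scalerA.
by rewrite -[rshift _ _]/(unsplit (inr i)) unsplitK.
Qed.

HB.instance Definition _ S :=
  GRing.isSubmodClosed.Build F M (lspan S) (lspan_submod_closed S).

Section Quotient.
Variable U : submodClosed M.

(* submodClosed does not inherit from zmodClosed, which Quotient.quot needs. *)
Definition zmod_of : {pred M} := U.
Fact zmod_of_closed : zmod_closed zmod_of.
Proof. exact: GRing.submod_closedB (submodClosedP U). Qed.
HB.instance Definition _ := GRing.isZmodClosed.Build M zmod_of zmod_of_closed.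

Definition lquot : Type := Quotient.quot zmod_of.
HB.instance Definition _ := GRing.Zmodule.on lquot.

Definition lquot_class (x : M) : lquot := \pi_(Quotient.quot zmod_of) x.

Lemma lquot_classP x y : lquot_class x = lquot_class y <-> x - y \in U.
Proof.
have := Quotient.idealrBE zmod_of x y; rewrite /lquot_class -[_ \in _]/(x - y \in U).
by move=> ->; split=> /eqP.
Qed.

Lemma lquot_classD : {morph lquot_class : x y / x + y}.
Proof. by move=> x y; rewrite /lquot_class [LHS]raddfD. Qed.

Lemma lquot_repr (q : lquot) : lquot_class (repr (q : Quotient.quot zmod_of)) = q.
Proof. exact: reprK. Qed.

Definition lquot_scale (a : F) (q : lquot) : lquot :=
  lquot_class (a *: repr (q : Quotient.quot zmod_of)).

Lemma lquot_classZ a x : lquot_scale a (lquot_class x) = lquot_class (a *: x).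
Proof.
by apply/lquot_classP; rewrite -scalerBr rpredZ//; apply/lquot_classP/lquot_repr.
Qed.

Fact lquot_scaleA a b q :
  lquot_scale a (lquot_scale b q) = lquot_scale (a * b) q.
Proof. by rewrite -[q]lquot_repr !lquot_classZ scalerA. Qed.

Fact lquot_scale1 : left_id 1 lquot_scale.
Proof. by move=> q; rewrite -[q]lquot_repr lquot_classZ scale1r. Qed.

Fact lquot_scaleDr : right_distributive lquot_scale +%R.
Proof.
move=> a p q; rewrite -[p]lquot_repr -[q]lquot_repr.
by rewrite -lquot_classD !lquot_classZ -lquot_classD scalerDr.
Qed.

Fact lquot_scaleDl q : {morph lquot_scale^~ q : a b / a + b}.
Proof.
by move=> a b /=; rewrite -[q]lquot_repr !lquot_classZ -lquot_classD scalerDl.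
Qed.

HB.instance Definition _ := GRing.Zmodule_isLmodule.Build F lquot
  lquot_scaleA lquot_scale1 lquot_scaleDr lquot_scaleDl.

End Quotient.
End Subspaces.

(* A formal series with exponents in G and coefficients in M is a function
   G -> M; G is int, int * int or int * int * int for one, two or three
   variables. The coefficients of a product are sums over all of G that have
   finite support wherever the product is used below (\sum_(i \in A) is 0 on
   infinite supports). *)

Section FormalCalculus.
Variable F : numFieldType.

Section Product.
Variable G : zmodType.

Definition fmul (M : lmodType F) (a : G -> F) (b : G -> M) : G -> M :=
  fun g => \sum_(h \in [set: G]) a h *: b (g - h).

Definition smul (a b : G -> F) : G -> F := fmul (M := F^o) a b.

Definition xmon (g : G) : G -> F := fun h => (h == g)%:R.

Definition spow (a : G -> F) (k : nat) : G -> F := iter k (smul a) (xmon 0).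

End Product.

Definition Res (M : Type) (a : int -> M) : M := a (- 1).

Definition gbinom (n : int) (k : nat) : F :=
  (\prod_(i < k) (n%:~R - i%:R)) / k`!%:R.

(* The coefficient of x^a y^b in (x - y)^n, n an integer. *)
Definition binsub (n a b : int) : F :=
  if b is Posz j then (a + b == n)%:R * ((- 1) ^+ j * gbinom n j) else 0.

(* An exponent p : int * int * int stands for x0^p.1.1 x1^p.1.2 x2^p.2. As
   delta(x) is the sum of all x^n, delta_012, delta_021 and delta_201 are
     x0^-1 delta((x1 - x2)/x0)  = \sum_n x0^(-n-1) (x1 - x2)^n,
     x0^-1 delta((x2 - x1)/-x0) = \sum_n (-1)^n x0^(-n-1) (x2 - x1)^n,
     x2^-1 delta((x1 - x0)/x2)  = \sum_n x2^(-n-1) (x1 - x0)^n. *)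
Definition delta_012 (p : int * int * int) : F :=
  binsub (- p.1.1 - 1) p.1.2 p.2.
Definition delta_021 (p : int * int * int) : F :=
  (- 1) ^ (- p.1.1 - 1) * binsub (- p.1.1 - 1) p.2 p.1.2.
Definition delta_201 (p : int * int * int) : F :=
  binsub (- p.2 - 1) p.1.2 p.1.1.

Definition x1_sub_x2 : int * int -> F := xmon (1, 0) \- xmon (0, 1).
Definition x1_div_x2_sub_1 : int * int -> F := xmon (1, - 1) \- xmon 0.

(* M((x1, x2)) *)
Definition laurent2 (M : lmodType F) (A : int * int -> M) : Prop :=
  exists N : int, forall a b : int, (a < N) || (b < N) -> A (a, b) = 0.

(* e^(c x) *)
Definition expx (c : F) : int -> F :=
  fun i => if i is Posz j then c ^+ j / j`!%:R else 0.

(* The substitution x1 = x2 e^x0 in A(x1, x2), as a series in x0 and x2 (in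
   this order): x1^a x2^b becomes e^(a x0) x2^(a+b). *)
Definition subst_exp (M : lmodType F) (A : int * int -> M) : int * int -> M :=
  fun p => \sum_(a \in [set: int]) expx a%:~R p.1 *: A (a, p.2 - a).

Definition expm1 : int -> F := expx 1 \- xmon 0.

(* 1 - (e^x - 1)/x, which has no terms of degree <= 0 *)
Definition expm1_tail : int -> F := xmon 0 \- smul (xmon (- 1)) expm1.

(* The inverse of e^x - 1 in C((x)): x^-1 times a geometric series; see
   expm1_invK. *)
Definition expm1_inv : int -> F :=
  fun i => \sum_(k \in [set: nat]) spow expm1_tail k (i + 1).

End FormalCalculus.

Arguments xmon {F G}.
Arguments delta_012 {F}.
Arguments delta_021 {F}.
Arguments delta_201 {F}.
Arguments x1_sub_x2 {F}.
Arguments x1_div_x2_sub_1 {F}.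
Arguments expm1 {F}.
Arguments expm1_tail {F}.
Arguments expm1_inv {F}.

Section ExpInverse.
Variable F : numFieldType.
Implicit Types (a b : int -> F).

Lemma smul_sum (G : zmodType) (a b : G -> F) g :
  smul a b g = \sum_(h \in [set: G]) a h * b (g - h).
Proof. by []. Qed.

Lemma smul_xmon (G : zmodType) (c : G) (b : G -> F) g :
  smul (xmon c) b g = b (g - c).
Proof.
rewrite smul_sum (fsbigTE [fset c]%fset) ?big_seq_fset1 /xmon ?eqxx ?mul1r//.
by move=> i; rewrite !inE => /negPf ->; rewrite mul0r.
Qed.

Lemma smul_laurent a b (p q : int) :
    (forall i : int, i < p -> a i = 0) -> (forall i : int, i < q -> b i = 0) ->
  forall (n : int) (N : nat), n - p - q < N%:Z ->
  smul a b n = \sum_(i < N) a (p + i%:Z) * b (n - p - i%:Z).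
Proof.
move=> a0 b0 n N nN; rewrite smul_sum.
rewrite (fsbigTE [fset (p + k%:Z)%R | k in iota 0 N]%fset) => [|i iN].
  rewrite big_imfset/=; last by move=> i j _ _ /addrI[].
  rewrite undup_id ?iota_uniq// -[X in iota 0 X]subn0 -/(index_iota 0 N) big_mkord.
  by apply: eq_bigr => i _; rewrite opprD addrA.
have [ip|pi] := ltP i p; first by rewrite a0 ?mul0r.
have [niq|qni] := ltP (n - i) q; first by rewrite b0 ?mulr0.
case/negP: iN; apply/imfsetP => /=.
by exists `|i - p|%N; [rewrite mem_iota | ]; lia.
Qed.

Lemma smul_supp a b (p q : int) :
    (forall i : int, i < p -> a i = 0) -> (forall i : int, i < q -> b i = 0) ->
  forall i : int, i < p + q -> smul a b i = 0.
Proof.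
move=> a0 b0 i ipq; rewrite (smul_laurent a0 b0 (N := 0)) ?big_ord0//; lia.
Qed.

Lemma expm1_tail_supp (i : int) : i < 1 -> expm1_tail i = 0 :> F.
Proof.
move=> i1; rewrite /expm1_tail /= smul_xmon /expm1 /xmon /=.
have [->|i0] := eqVneq i 0; first by rewrite /expx/= !expr1 divr1 subr0 subrr.
have -> : i - - 1 = i + 1 by lia.
case: i i1 i0 => [[|i]|i] // _ _; rewrite sub0r.
have -> : Negz i + 1 = - i%:Z by lia.
case: i => [|i]; first by rewrite /expx /= expr0 divr1 subrr oppr0.
by rewrite /expx /= subr0 oppr0.
Qed.

Lemma spow_expm1_tail_supp k (i : int) :
  i < k%:Z -> spow expm1_tail k i = 0 :> F.
Proof.
elim: k i => [|k IHk] i ik; first by rewrite /spow /= /xmon lt_eqF.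
rewrite /spow iterS.
apply: (smul_supp (p := 1) (q := k%:Z)) => [j|j /IHk//|]; last lia.
exact: expm1_tail_supp.
Qed.

Lemma expm1E i : expm1 i = xmon 0 (i - 1) - expm1_tail (i - 1) :> F.
Proof.
rewrite /expm1_tail /= opprB addrC subrK smul_xmon; congr expm1; lia.
Qed.

Lemma expm1_invE (N : nat) (i : int) : i < N%:Z ->
  expm1_inv i = \sum_(k < N.+1) spow expm1_tail k (i + 1) :> F.
Proof.
move=> iN; rewrite /expm1_inv (fsbigTE [fset k in iota 0 N.+1]%fset) => [|k].
  rewrite big_imfset// -[enum_finmem _]/(undup (iota 0 N.+1)) undup_id ?iota_uniq//.
  by rewrite -[X in iota 0 X]subn0 -/(index_iota 0 N.+1) big_mkord.
move=> kN; apply: spow_expm1_tail_supp; have [kN1|] := ltnP k N.+1; last lia.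
have kI : k \in iota 0 N.+1 by rewrite mem_iota; lia.
by case/negP: kN; apply/imfsetP; exists k.
Qed.

Lemma expm1_inv_supp (i : int) : i < - 1 -> expm1_inv i = 0 :> F.
Proof.
move=> i1; rewrite (expm1_invE (N := 0)) ?big_ord1; last lia.
by apply: spow_expm1_tail_supp; lia.
Qed.

Lemma expm1_invK : smul expm1 expm1_inv = xmon 0 :> (int -> F).
Proof.
apply/funext => n.
have e0 (i : int) : i < 1 -> expm1 i = 0 :> F.
  move=> i1; rewrite expm1E expm1_tail_supp; last lia.
  by rewrite /xmon subr0; case: eqP => //; lia.
pose N := `|n|.+1.
rewrite (smul_laurent e0 expm1_inv_supp (N := N)); last by rewrite /N; lia.
under eq_bigr => i _.
  rewrite (expm1_invE (N := N)); last by rewrite /N; lia.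
  rewrite expm1E mulrBl !mulr_sumr -sumrB.
  over.
rewrite exchange_big /=.
have step (k : nat) : \sum_(i < N)
    (xmon 0 (1 + i%:Z - 1) * spow expm1_tail k (n - 1 - i%:Z + 1) -
     expm1_tail (1 + i%:Z - 1) * spow expm1_tail k (n - 1 - i%:Z + 1)) =
    spow expm1_tail k n - spow expm1_tail k.+1 n :> F.
  rewrite sumrB; congr (_ - _).
    rewrite big_ord_recl big1 => [|i _]; last first.
      by rewrite /xmon; case: eqP; [rewrite /= /bump; lia | rewrite mul0r].
    rewrite addr0 /xmon /= mul1r; congr spow; lia.
  rewrite /spow iterS.
  have t0 (i : int) : i < 0 -> expm1_tail i = 0 :> F.
    by move=> i0; apply: expm1_tail_supp; lia.
  have s0 (i : int) : i < 0 -> spow expm1_tail k i = 0 :> F.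
    by move=> i0; apply: spow_expm1_tail_supp; lia.
  rewrite (smul_laurent t0 s0 (N := N)); last by rewrite /N; lia.
  by apply: eq_bigr => i _; congr (_ * _); [congr expm1_tail | congr spow]; lia.
under eq_bigr do rewrite step.
rewrite -(big_mkord xpredT (fun k => spow expm1_tail k n - spow expm1_tail k.+1 n)).
rewrite (telescope_sumr_eq (fun k => - spow expm1_tail k n)) //.
  rewrite (spow_expm1_tail_supp (k := N.+1)); last by rewrite /N; lia.
  by rewrite oppr0 opprK add0r.
by move=> k _; rewrite opprK addrC.
Qed.

End ExpInverse.

(* Y u n v is the coefficient u_n v of x^(-n-1) in Y(u, x)v. *)

Section Fields.
Variables (F : numFieldType) (V : lmodType F) (Y : V -> int -> V -> V).

(* Y(u, x)v as a series in x *)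
Definition Yser (u v : V) : int -> V := fun i => Y u (- i - 1) v.

(* Y(u, x1)Y(v, x2)w and Y(v, x2)Y(u, x1)w, and then Y(Y(u, x0)v, x2)w, as
   series in x0, x1 and x2 *)
Definition YY_12 (u v w : V) : int * int * int -> V := fun p =>
  if p.1.1 == 0 then Y u (- p.1.2 - 1) (Y v (- p.2 - 1) w) else 0.
Definition YY_21 (u v w : V) : int * int * int -> V := fun p =>
  if p.1.1 == 0 then Y v (- p.2 - 1) (Y u (- p.1.2 - 1) w) else 0.
Definition YY_02 (u v w : V) : int * int * int -> V := fun p =>
  if p.1.2 == 0 then Y (Y u (- p.1.1 - 1) v) (- p.2 - 1) w else 0.

(* s is the list of the pairs (u^(i), v^(i)). *)
Definition S_jacobi (u v : V) (s : seq (V * V)) : Prop :=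
  forall w p,
    fmul delta_012 (YY_12 u v w) p
    - fmul delta_021 (fun q => \sum_(t <- s) YY_21 t.1 t.2 w q) p
    = fmul delta_201 (YY_02 u v w) p.

End Fields.

Record wqva (F : numFieldType) := WQVA {
  wqva_space :> lmodType F;
  vop : wqva_space -> int -> wqva_space -> wqva_space;
  vac : wqva_space;
  vop_linearl : forall n v, linear (fun u => vop u n v);
  vop_linearr : forall u n, linear (vop u n);
  vop_trunc : forall u v, exists N : int, forall n, N <= n -> vop u n v = 0;
  vop_vacl : forall n v, vop vac n v = if n == - 1 then v else 0;
  vop_vacr_reg : forall v n, 0 <= n -> vop v n vac = 0;
  vop_vacr_lim : forall v, vop v (- 1) vac = v;
  vop_jacobi : forall u v, exists s, S_jacobi vop u v s
}.

Arguments vac {F w}.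

Definition vderiv (F : numFieldType) (V : wqva F) (v : V) : V :=
  vop v (- 2) vac.

(* Here phi(x, z) = x e^z, and YW v m w is the coefficient v_[m] w of x^(-m) in
   Y_W(v, x)w. *)

Section PhiFields.
Variables (F : numFieldType) (V : wqva F) (W : lmodType F).
Variable YW : V -> int -> W -> W.

(* Y_W(u, x1)Y_W(v, x2)w *)
Definition YWYW (u v : V) (w : W) : int * int -> W :=
  fun p => YW u (- p.1) (YW v (- p.2) w).

Definition phi_assoc (u v : V) (k : nat) : Prop :=
  (forall w, laurent2 (fmul (spow x1_sub_x2 k) (YWYW u v w))) /\
  (forall w (i j : int),
    (* the coefficient of x0^i x2^j *)
    fmul (spow expm1 k) (fun l => YW (Yser (@vop F V) u v l) (- j) w) i
    = subst_exp (fmul (spow x1_div_x2_sub_1 k) (YWYW u v w)) (i, j)).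

End PhiFields.

Record phi_module (F : numFieldType) (V : wqva F) := PhiModule {
  phimod_space :> lmodType F;
  phimod_op : V -> int -> phimod_space -> phimod_space;
  phimod_linearl : forall m w, linear (fun v => phimod_op v m w);
  phimod_linearr : forall v m, linear (phimod_op v m);
  phimod_trunc : forall v w, exists N : int,
    forall m, N <= m -> phimod_op v m w = 0;
  phimod_vac : forall m w, phimod_op vac m w = if m == 0 then w else 0;
  phimod_assoc : forall u v, exists k : nat, phi_assoc phimod_op u v k
}.

Section Grading.
Variables (F : numFieldType) (V : wqva F) (W : phi_module V).

Definition sum_of_components (gr : nat -> {pred W}) (w : W) : Prop :=
  exists (N : nat) (c : 'I_N -> W),
    (forall i, c i \in gr i) /\ w = \sum_(i < N) c i.

Definition direct_sum_decomposition (gr : nat -> submodClosed W) : Prop :=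
  (forall w, sum_of_components gr w) /\
  (forall (N : nat) (c : 'I_N -> W), (forall i, c i \in gr i) ->
     \sum_(i < N) c i = 0 -> forall i, c i = 0).

(* W[p] for p an integer, zero for p < 0 *)
Definition component (gr : nat -> submodClosed W) (p : int) : {pred W} :=
  if p is Posz n then mem (gr n) else pred1 0.

Definition N_grading (gr : nat -> submodClosed W) : Prop :=
  direct_sum_decomposition gr /\
  (forall (v : V) (m : int) (n : nat) (w : W), w \in gr n ->
     phimod_op v m w \in component gr (n%:Z - m)).

Definition graded_submodule (gr : nat -> submodClosed W) (U : submodClosed W) :
    Prop :=
  (forall (v : V) (m : int) (w : W), w \in U -> phimod_op v m w \in U) /\
  (forall w, w \in U ->
     sum_of_components (fun i => [predI gr i & U]) w).

Definition graded_irreducible (gr : nat -> submodClosed W) : Prop :=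
  (exists w : W, w != 0) /\
  (forall U : submodClosed W, graded_submodule gr U ->
     (forall w, w \in U -> w = 0) \/ (forall w, w \in U)).

End Grading.

Section Zhu.
Variables (F : numFieldType) (V : wqva F) (n : nat).

Definition zhu_f : int -> F := fun j =>
  \sum_(i < n.+1) gbinom F (- n%:Z - 1) i *
    smul (expx n.+1%:R) (spow expm1_inv (i + n + 1)) j.

Definition zhu_mul (u v : V) : V := Res (fmul zhu_f (Yser (@vop F V) u v)).

Definition zhu_circ (u v : V) : V :=
  Res (fmul (smul (expx n.+1%:R) (spow expm1_inv (2 * n + 2)))
            (Yser (@vop F V) u v)).

Definition zhu_O : submodClosed V :=
  lspan ([set w | exists v, w = vderiv v] `|`
         [set w | exists u v, w = zhu_circ u v]).

Definition zhu : lmodType F := lquot zhu_O.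

Definition zhu_class : V -> zhu := @lquot_class F V zhu_O.

(* The product of zhu is induced by zhu_mul, that is, the product of the
   classes of u and v is the class of zhu_mul u v; its unit is the class of
   vac. *)
Record zhu_module (M : lmodType F) (act : zhu -> M -> M) : Prop := ZhuModule {
  zhu_act_linearl : forall x, linear (fun a => act a x);
  zhu_act_linearr : forall a, linear (act a);
  zhu_act1 : forall x, act (zhu_class vac) x = x;
  zhu_actM : forall u v x,
    act (zhu_class (zhu_mul u v)) x
    = act (zhu_class u) (act (zhu_class v) x)
}.

Definition zhu_irreducible (M : lmodType F) (act : zhu -> M -> M) : Prop :=
  (exists x : M, x != 0) /\
  (forall U : submodClosed M,
     (forall a x, x \in U -> act a x \in U) ->
     (forall x, x \in U -> x = 0) \/ (forall x, x \in U)).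

End Zhu.

Section Omega.
Variables (F : numFieldType) (V : wqva F) (W : phi_module V) (n : nat).

Definition Omega_pred : {pred W} := fun w =>
  `[< forall (v : V) (m : int), n.+1%:Z <= m -> phimod_op v m w = 0 >].

Fact Omega_closed : submod_closed Omega_pred.
Proof.
have phi0 v m : phimod_op v m 0 = 0 :> W.
  have := phimod_linearr (p := W) v m (-1) 0 0.
  by rewrite scaler0 addr0 scaleN1r addNr.
split=> [|a x y /asboolP x0 /asboolP y0]; apply/asboolP => v m nm.
  exact: phi0.
by rewrite phimod_linearr x0// y0// scaler0 addr0.
Qed.

HB.instance Definition _ :=
  GRing.isSubmodClosed.Build F W Omega_pred Omega_closed.

Definition Omega : submodClosed W := Omega_pred.

End Omega.

Definition acts_by_zero_mode (F : numFieldType) (V : wqva F)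
    (W : phi_module V) (n : nat) (U : submodClosed W)
    (act : zhu V n -> subspace_of U -> subspace_of U) : Prop :=
  forall (v : V) (x : subspace_of U),
    subspace_val (act (zhu_class n v) x) = phimod_op v 0 (subspace_val x).

(* Main.v *)
Require Import Defs.
From HB Require Import structures.
From mathcomp Require Import all_boot all_order all_algebra.
From mathcomp Require Import boolp classical_sets functions fsbigop.
From mathcomp Require Import finmap reals complex ring zify.

Set Implicit Arguments.
Unset Strict Implicit.
Unset Printing Implicit Defensive.

Import Order.TTheory GRing.Theory Num.Theory.
Local Open Scope ring_scope.
Local Open Scope classical_set_scope.

(** Fix u, v in V, a vector w of a phi-coordinated module and a total degree d,
    and let alpha(z) be the sum of the u_[-a] v_[a-d] w z^a.  Associativity
    says that, for k large, P(z) = (z - 1)^k alpha(z) is a Laurent polynomial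
    and that
      (e^x - 1)^k g(x) = P(e^x),
    where g(x) is the sum of the (u_(-l-1) v)_[-d] w x^l ([ex_assoc]).
    Everything follows from this one-variable identity.

    - The series e^(ax) are linearly independent, so the coefficients of P lie
      in the span of the vectors y_[-d] w; the truncation of alpha from above
      allows a division by (z - 1)^k that stays in this span.  Hence
      u_[m] v_[q] w is a combination of vectors y_[m+q] w ([mode_mode_mem]).
      Thus zero modes preserve Omega_n, and the submodule generated by a set of
      vectors is spanned by single modes applied to these vectors.

    - Let d = 0 and w in Omega_n, so that alpha has no power of z above n.  The
      S-Jacobi identity applied to the vacuum gives a skew symmetry of V up to
      vectors whose zero mode vanishes: g(x) is the sum of the g_i(-x), where
      g_i is the series of the pair (v^(i), u^(i)).  As x -> -x is z -> 1/z, the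
      upper bounds for the pairs (v^(i), u^(i)) become a lower bound for P: it
      has no power below -n ([ex_assoc_Omega]).

    - Consequently Res_x e^((n+1)x) (e^x - 1)^(-N-1) g(x), computed with the
      coordinate z = e^x, is the coefficient of (z - 1)^(N+k) in the polynomial
      z^n P(z).  It equals the sum over 0 <= b <= 2n of the
      C(b, N) u_[n-b] v_[b-n] w ([fmul_vertex_ser_Omega]).  For the circle
      product, N = 2n + 1 exceeds every b, so the result is zero.  For the star
      product the coefficients add up to 1 at b = n and to 0 elsewhere
      ([sum_gbinom_bin]), which leaves u_[0] v_[0] w.  So v |-> v_[0] induces
      an action of the Zhu algebra on Omega_n.

    - In the graded irreducible case with W[0] nonzero, a nonzero homogeneous w
      of degree e in Omega_0 generates a submodule that lives in degrees >= e,
      so e = 0.  The degree 0 part of the submodule generated by an invariant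
      subspace M of W[0] is M itself, so M is W[0] as soon as it is nonzero
      ([graded_generation]). *)

(** * Formal Laurent series in one variable *)

(** The bridge from sums over all integers to ordinary finite sums. *)
Lemma fsum_window (M : nmodType) (f : int -> M) (p : int) (N : nat) :
    (forall a, (a < p) || (p + N%:Z <= a) -> f a = 0) ->
  \sum_(a \in [set: int]) f a = \sum_(i < N) f (p + i%:Z).
Proof.
move=> f0; rewrite (fsbigTE [fset (p + k%:Z)%R | k in iota 0 N]%fset) => [|i iN].
  rewrite big_imfset/=; last by move=> i j _ _ /addrI[].
  by rewrite undup_id ?iota_uniq// -[X in iota 0 X]subn0 -/(index_iota 0 N) big_mkord.
apply: f0; apply: contraR iN; rewrite negb_or -leNgt -ltNge => /andP[pi iN].
by apply/imfsetP; exists `|i - p|%N; [rewrite /= mem_iota | ]; lia.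
Qed.

Definition order_ge (M : zmodType) (p : int) (b : int -> M) : Prop :=
  forall i, i < p -> b i = 0.

Section Convolution.
Variable F : numFieldType.
Implicit Types (M : lmodType F).

Lemma fmul_window M (a : int -> F) (b : int -> M) (p q n : int) (N : nat) :
    order_ge p a -> order_ge q b -> n - p - q < N%:Z ->
  fmul a b n = \sum_(i < N) a (p + i%:Z) *: b (n - p - i%:Z).
Proof.
move=> a0 b0 nN; rewrite /fmul (fsum_window (p := p) (N := N)) => [|i].
  by apply: eq_bigr => i _; rewrite opprD addrA.
case/orP => ip; first by rewrite a0// scale0r.
by rewrite b0 ?scaler0//; lia.
Qed.

Lemma fmul_order_ge M (a : int -> F) (b : int -> M) p q :
  order_ge p a -> order_ge q b -> order_ge (p + q) (fmul a b).
Proof.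
move=> a0 b0 i ipq; rewrite (fmul_window (N := 0) a0 b0) ?big_ord0//; lia.
Qed.

(** The lower bounds matter: they make the double sum finite, so that its
    order can be exchanged. The right factor takes values in a module, which
    is why this is not just associativity in a ring. *)
Lemma fmulA M (a b : int -> F) (c : int -> M) p q r :
    order_ge p a -> order_ge q b -> order_ge r c ->
  fmul (smul a b) c = fmul a (fmul b c).
Proof.
move=> a0 b0 c0; apply/funext => n.
pose N := (absz (n - p - q - r)%R).+1.
rewrite (fmul_window (N := N) (smul_supp a0 b0) c0); last by rewrite /N; lia.
rewrite (fmul_window (N := N) a0 (fmul_order_ge b0 c0)); last by rewrite /N; lia.
transitivity (\sum_(i < N) \sum_(j < N)
    (a (p + j%:Z) * b (q + i%:Z - j%:Z)) *: c (n - (p + q) - i%:Z)).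
  apply: eq_bigr => i _; rewrite -scaler_suml; congr (_ *: _).
  rewrite /smul (fmul_window (N := N) a0 (b := b : int -> F^o) b0); last first.
    by move: (ltn_ord i); lia.
  by apply: eq_bigr => j _; congr (_ * b _); lia.
rewrite exchange_big; apply: eq_bigr => j _ /=.
have b1 : order_ge (q - j%:Z) b by move=> i iq; apply: b0; lia.
rewrite (fmul_window (N := N) b1 c0); last by rewrite /N; lia.
rewrite scaler_sumr; apply: eq_bigr => i _.
by rewrite scalerA; congr (_ * b _ *: c _); lia.
Qed.

Lemma smulC (G : zmodType) (a b : G -> F) : smul a b = smul b a.
Proof.
apply/funext => g; rewrite !smul_sum (reindex_fsbigT (fun h => g - h)).
  by apply: eq_fsbigr => h _; rewrite subKr mulrC.
by exists (fun h => g - h) => h; rewrite subKr.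
Qed.

Lemma fmulDl M (a a' : int -> F) (b : int -> M) p q :
    order_ge p a -> order_ge p a' -> order_ge q b ->
  fmul (a + a') b = fmul a b + fmul a' b.
Proof.
move=> a0 a0' b0; apply/funext => n; rewrite -[RHS]/(fmul a b n + fmul a' b n).
pose N := (absz (n - p - q)%R).+1; have nN : n - p - q < N%:Z by rewrite /N; lia.
have a1 : order_ge p (a + a').
  by move=> i ip; rewrite -[LHS]/(a i + a' i) a0// a0'// addr0.
rewrite !(fmul_window (N := N) (p := p) (q := q)) // -big_split /=.
by apply: eq_bigr => i _; rewrite -scalerDl.
Qed.

Definition is_laurent : {pred (int -> F)} :=
  fun a => `[< exists p, order_ge p a >].

Lemma order_ge_le (U : zmodType) p q (b : int -> U) :
  p <= q -> order_ge q b -> order_ge p b.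
Proof. by move=> pq b0 i ip; apply: b0; apply: lt_le_trans pq. Qed.

Fact is_laurent_zmod_closed : zmod_closed is_laurent.
Proof.
split=> [|a b /asboolP[p a0] /asboolP[q b0]]; apply/asboolP; first by exists 0.
exists (Num.min p q) => i ipq; rewrite -[LHS]/(a i - b i) a0 ?b0 ?subr0//.
all: lia.
Qed.
HB.instance Definition _ :=
  GRing.isZmodClosed.Build (int -> F) is_laurent is_laurent_zmod_closed.

(** Bundling the lower bound turns F((x)) into a commutative ring, in which
    identities between series can be checked by ring computations. *)
Inductive laurent : predArgType := Laurent a & a \in is_laurent.
Definition lcoef (x : laurent) : int -> F := let: Laurent a _ := x in a.
HB.instance Definition _ := [isSub of laurent for lcoef].
HB.instance Definition _ := [Choice of laurent by <:].
HB.instance Definition _ := [SubChoice_isSubZmodule of laurent by <:].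

Lemma lcoefP (x : laurent) : exists p, order_ge p (lcoef x).
Proof. by case: x => a aL /=; apply/asboolP. Qed.

Fact laurent_mul_subproof (x y : laurent) : smul (lcoef x) (lcoef y) \in is_laurent.
Proof.
case: (lcoefP x) (lcoefP y) => p x0 [q y0].
by apply/asboolP; exists (p + q); apply: smul_supp.
Qed.
Definition laurent_mul x y := Laurent (laurent_mul_subproof x y).

Fact laurent_one_subproof : (xmon 0 : int -> F) \in is_laurent.
Proof. by apply/asboolP; exists 0 => i i0; rewrite /xmon lt_eqF. Qed.
Definition laurent_one := Laurent laurent_one_subproof.

Fact laurent_mulA : associative laurent_mul.
Proof.
move=> x y z; apply: val_inj => /=.
case: (lcoefP x) (lcoefP y) (lcoefP z) => p x0 [q y0] [r z0].
by rewrite /smul -(fmulA (c := lcoef z : int -> F^o) x0 y0 z0).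
Qed.
Fact laurent_mulC : commutative laurent_mul.
Proof. by move=> x y; apply: val_inj; apply: smulC. Qed.
Fact laurent_mul1 : left_id laurent_one laurent_mul.
Proof.
move=> x; apply: val_inj; apply/funext => i.
by rewrite /= smul_xmon subr0.
Qed.
Fact laurent_mulDl : left_distributive laurent_mul +%R.
Proof.
move=> x y z; apply: val_inj.
case: (lcoefP x) (lcoefP y) (lcoefP z) => p x0 [q y0] [r z0].
apply: (fmulDl (b := lcoef z : int -> F^o) (p := Num.min p q) (q := r)) z0.
  by apply: order_ge_le x0; lia.
by apply: order_ge_le y0; lia.
Qed.
Fact laurent_one_neq0 : laurent_one != 0.
Proof.
apply/eqP => /(congr1 (fun x => lcoef x 0)) /eqP.
by rewrite /= /xmon eqxx oner_eq0.
Qed.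
HB.instance Definition _ := GRing.Zmodule_isComNzRing.Build laurent
  laurent_mulA laurent_mulC laurent_mul1 laurent_mulDl laurent_one_neq0.

Lemma lcoefM x y : lcoef (x * y) = smul (lcoef x) (lcoef y).
Proof. by []. Qed.
Lemma lcoef1 : lcoef 1 = xmon 0. Proof. by []. Qed.
Lemma lcoefD x y i : lcoef (x + y) i = lcoef x i + lcoef y i.
Proof. by []. Qed.
Lemma lcoefN x i : lcoef (- x) i = - lcoef x i.
Proof. by []. Qed.
Lemma lcoefMn x k i : lcoef (x *+ k) i = lcoef x i *+ k.
Proof. by elim: k => // k IH; rewrite !mulrS lcoefD IH. Qed.
Lemma lcoefX x k : lcoef (x ^+ k) = spow (lcoef x) k.
Proof. by elim: k => [|k IH] //; rewrite exprS lcoefM IH. Qed.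
Lemma lcoef_inj : injective lcoef. Proof. exact: val_inj. Qed.

Lemma fmul_lcoefM M x y (c : int -> M) r : order_ge r c ->
  fmul (lcoef (x * y)) c = fmul (lcoef x) (fmul (lcoef y) c).
Proof.
case: (lcoefP x) (lcoefP y) => p x0 [q y0] c0; exact: fmulA x0 y0 c0.
Qed.

End Convolution.

(** * Residues of exponential series *)

Section Exponential.
Variable F : numFieldType.
Implicit Types (x y : laurent F).

Lemma expx_order_ge (c : F) : order_ge 0 (expx c).
Proof. by case. Qed.

Fact lexp_subproof (c : F) : expx c \in @is_laurent F.
Proof. by apply/asboolP; exists 0; apply: expx_order_ge. Qed.
Definition lexp c := Laurent (lexp_subproof c).

Lemma expx0 (i : int) : expx 0 i = (i == 0)%:R :> F.
Proof. by case: i => [[|i]|i] //=; rewrite expr0n /= ?mul0r ?divr1. Qed.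

Lemma lexp0 : lexp 0 = 1.
Proof. by apply: lcoef_inj; apply/funext => i; rewrite lcoef1 /= expx0. Qed.

(** The binomial theorem, degree by degree. *)
Lemma lexpD c d : lexp (c + d) = lexp c * lexp d.
Proof.
apply: lcoef_inj; apply/funext => -[n|n]; rewrite lcoefM /=; last first.
  rewrite (smul_supp (@expx_order_ge c) (@expx_order_ge d)) ?addr0 //.
rewrite (smul_laurent (@expx_order_ge c) (@expx_order_ge d) (N := n.+1)); last lia.
rewrite addrC exprDn mulr_suml; apply: eq_bigr => i _.
have -> : n%:Z - 0 - i%:Z = (n - i)%N by move: (ltn_ord i); lia.
rewrite add0r /= -(bin_fact (leq_ord i)) !natrM -mulr_natr.
have nz k : k`!%:R != 0 :> F by rewrite pnatr_eq0 -lt0n fact_gt0.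
have bnz : 'C(n, i)%:R != 0 :> F by rewrite pnatr_eq0 -lt0n bin_gt0 leq_ord.
by field; rewrite !nz.
Qed.

Definition lexpm1 : laurent F := lexp 1 - 1.

Lemma lcoef_expm1 : lcoef lexpm1 = expm1.
Proof. by []. Qed.

Fact lexpm1_inv_subproof : expm1_inv \in @is_laurent F.
Proof. by apply/asboolP; exists (- 1) => i i1; apply: expm1_inv_supp. Qed.
Definition lexpm1_inv := Laurent lexpm1_inv_subproof.

Lemma lexpm1K : lexpm1 * lexpm1_inv = 1.
Proof. by apply: lcoef_inj; apply: expm1_invK. Qed.

Fact lderiv_subproof x :
  (fun i => (i + 1)%:~R * lcoef x (i + 1)) \in @is_laurent F.
Proof.
case: (lcoefP x) => p x0; apply/asboolP; exists (p - 1) => i ip.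
by rewrite x0 ?mulr0//; lia.
Qed.
Definition lderiv x := Laurent (lderiv_subproof x).

Lemma lderivE x i : lcoef (lderiv x) i = (i + 1)%:~R * lcoef x (i + 1).
Proof. by []. Qed.

Lemma lderiv1 : lderiv 1 = 0.
Proof.
apply: lcoef_inj; apply/funext => i; rewrite lderivE lcoef1 /xmon.
by case: eqP => [->|_]; rewrite ?mul0r ?mulr0.
Qed.

(** The exponent -1 is the one that a derivative never reaches. *)
Lemma Res_lderiv x : Res (lcoef (lderiv x)) = 0.
Proof. by rewrite /Res lderivE addNr mul0r. Qed.

Lemma lderivM x y : lderiv (x * y) = lderiv x * y + x * lderiv y.
Proof.
case: (lcoefP x) (lcoefP y) => p x0 [q y0].
have dx0 : order_ge (p - 1) (lcoef (lderiv x)).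
  by move=> i ip; rewrite lderivE x0 ?mulr0//; lia.
have dy0 : order_ge (q - 1) (lcoef (lderiv y)).
  by move=> i iq; rewrite lderivE y0 ?mulr0//; lia.
apply: lcoef_inj; apply/funext => n.
rewrite lderivE [RHS]lcoefD !lcoefM.
pose N := (absz (n + 1 - p - q)%R).+1.
rewrite (smul_laurent x0 y0 (N := N)); last by rewrite /N; lia.
rewrite (smul_laurent dx0 y0 (N := N)); last by rewrite /N; lia.
rewrite (smul_laurent x0 dy0 (N := N)); last by rewrite /N; lia.
rewrite -big_split mulr_sumr; apply: eq_bigr => i _ /=.
have -> : p - 1 + i%:Z + 1 = p + i%:Z by lia.
have -> : n - (p - 1) - i%:Z = n + 1 - p - i%:Z by lia.
have -> : n - p - i%:Z + 1 = n + 1 - p - i%:Z by lia.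
have -> : (n + 1)%:~R = (p + i%:Z)%:~R + (n + 1 - p - i%:Z)%:~R :> F.
  by rewrite -rmorphD; congr _%:~R; lia.
ring.
Qed.

Lemma lderiv_lexp1 : lderiv (lexp 1) = lexp 1.
Proof.
apply: lcoef_inj; apply/funext => i; rewrite lderivE.
case: i => [n|n] /=; last first.
  by case: n => [|n]; rewrite ?addNr ?mul0r// /expx /= ?mulr0.
rewrite -[n%:Z + 1]/(n + 1)%N%:Z addn1 /= !expr1n factS natrM invfM mulrCA.
rewrite -[_%:~R]/(n.+1%:R).
by rewrite !mul1r mulVKf ?pnatr_eq0 // mulrC mulfK ?pnatr_eq0.
Qed.

Lemma lderivB x y : lderiv (x - y) = lderiv x - lderiv y.
Proof.
apply: lcoef_inj; apply/funext => i.
by rewrite lderivE !(lcoefD, lcoefN) !lderivE mulrBr.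
Qed.

Lemma lderiv_expm1_inv : lderiv lexpm1_inv = - (lexp 1 * lexpm1_inv ^+ 2).
Proof.
have /(congr1 lderiv) := lexpm1K.
rewrite lderivM lderiv1 lderivB lderiv1 subr0 lderiv_lexp1 => dK.
rewrite -[LHS]mul1r -[in LHS]lexpm1K.
transitivity (lexpm1_inv * (lexp 1 * lexpm1_inv + lexpm1 * lderiv lexpm1_inv)
              - lexp 1 * lexpm1_inv ^+ 2); first by ring.
by rewrite dK mulr0 sub0r.
Qed.

Lemma lderiv_expm1_invX k :
  lderiv (lexpm1_inv ^+ k.+1) = - (lexp 1 * lexpm1_inv ^+ k.+2) *+ k.+1.
Proof.
elim: k => [|k IH]; first by rewrite expr1 lderiv_expm1_inv.
rewrite exprS lderivM IH lderiv_expm1_inv.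
by rewrite (mulrS _ k.+1) mulrnAr; congr (_ + _ *+ _); rewrite !exprS; ring.
Qed.

(** e^x (e^x - 1)^(-k) is a derivative unless k = 1. *)
Lemma Res_lexp1_expm1_inv (k : nat) :
  Res (lcoef (lexp 1 * lexpm1_inv ^+ k)) = (k == 1%N)%:R.
Proof.
case: k => [|[|k]].
- by rewrite mulr1.
- have -> : lexp 1 * lexpm1_inv ^+ 1 = 1 + lexpm1_inv.
    by rewrite expr1 -lexpm1K /lexpm1; ring.
  rewrite /Res lcoefD lcoef1 /= /xmon /= add0r (expm1_invE _ (N := 0)) //.
  by rewrite big_ord1.
have := Res_lderiv (lexpm1_inv ^+ k.+1).
rewrite lderiv_expm1_invX /Res lcoefMn lcoefN => /eqP.
by rewrite mulrn_eq0 /= oppr_eq0 => /eqP.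
Qed.

(** In the coordinate z = e^x this is the coefficient of (z - 1)^k in z^b, and
    the induction on b is Pascal's rule. *)
Lemma Res_lexp_expm1_inv (b k : nat) :
  Res (lcoef (lexp b.+1%:R * lexpm1_inv ^+ k.+1)) = 'C(b, k)%:R.
Proof.
elim: b k => [|b IH] k.
  by rewrite Res_lexp1_expm1_inv eqSS; case: k.
have -> : lexp b.+2%:R * lexpm1_inv ^+ k.+1 =
    lexp b.+1%:R * lexpm1_inv ^+ k.+1 + lexp b.+1%:R * lexpm1_inv ^+ k.
  rewrite -[in RHS](mulr1 (_ * _ ^+ k)) -[X in _ + _ * X]lexpm1K /lexpm1.
  rewrite -natr1 lexpD exprS.
  by move: (lexp 1) (lexp _) (lexpm1_inv ^+ k) lexpm1_inv => e eb ik i; ring.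
rewrite /Res lcoefD -/(Res _) IH; case: k => [|k].
  rewrite mulr1 /= -[RHS]addr0 !bin0; congr (_ + _).
by rewrite -[lcoef _ _]/(Res _) IH binS natrD addrC.
Qed.

End Exponential.

(** * Spans and linearity of products *)

Section Span.
Variables (F : fieldType) (M : lmodType F).

Lemma lspan_sub (S : set M) (U : submodClosed M) x :
  (forall s, S s -> s \in U) -> x \in lspan S -> x \in U.
Proof.
move=> SU /lspanP[r [a [s [Ss ->]]]].
by apply: rpred_sum => i _; rewrite rpredZ// SU.
Qed.

Lemma mem_lspan (S : set M) x : S x -> x \in lspan S.
Proof.
move=> Sx; apply/lspanP; exists 1%N, (fun=> 1), (fun=> x).
by rewrite big_ord1 scale1r.
Qed.

Lemma lspan_set0 x : x \in lspan (set0 : set M) -> x = 0.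
Proof. by case/lspanP=> r [a [s [S0 ->]]]; apply: big1 => i _; case: (S0 i). Qed.

End Span.

Section FmulLinear.
Variables (F : numFieldType) (M : lmodType F).
Implicit Types (x y : laurent F) (b : int -> M).

Lemma fmul_suml n (c : 'I_n -> F) (a : 'I_n -> int -> F) b p r j :
    (forall i, order_ge p (a i)) -> order_ge r b ->
  fmul (fun l => \sum_(i < n) c i * a i l) b j = \sum_(i < n) c i *: fmul (a i) b j.
Proof.
move=> a0 b0; pose N := (absz (j - p - r)%R).+1.
have jN : j - p - r < N%:Z by rewrite /N; lia.
rewrite (fmul_window (p := p) _ b0 jN) => [|l lp]; last first.
  by apply: big1 => i _; rewrite a0 ?mulr0.
under [RHS]eq_bigr => i _ do rewrite (fmul_window (a0 i) b0 jN) scaler_sumr.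
rewrite exchange_big; apply: eq_bigr => l _ /=.
by rewrite scaler_suml; apply: eq_bigr => i _; rewrite scalerA.
Qed.

Lemma fmul_lcoefD x y b r : order_ge r b ->
  fmul (lcoef (x + y)) b = fmul (lcoef x) b + fmul (lcoef y) b.
Proof.
case: (lcoefP x) (lcoefP y) => p x0 [q y0] b0.
apply: (fmulDl (p := Num.min p q)) b0; first by apply: order_ge_le x0; lia.
by apply: order_ge_le y0; lia.
Qed.

Lemma fmul_lcoef1 b : fmul (lcoef 1) b = b.
Proof.
apply/funext => g; rewrite lcoef1 /fmul (fsum_window (p := 0) (N := 1)) => [|i].
  by rewrite big_ord1 /= addr0 subr0 /xmon eqxx scale1r.
by rewrite /xmon; case: eqP => [|_]; [lia | rewrite scale0r].
Qed.

Lemma fmul_lcoefN x b r : order_ge r b -> fmul (lcoef (- x)) b = - fmul (lcoef x) b.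
Proof.
move=> b0; apply/eqP; rewrite -subr_eq0 opprK -(fmul_lcoefD _ _ b0) addNr.
apply/eqP/funext => i; rewrite /fmul fsbig1// => j _.
by rewrite -[lcoef 0 j]/(0 : F) scale0r.
Qed.

Lemma fmul_linear x (c : F) b b' r r' : order_ge r b -> order_ge r' b' ->
  fmul (lcoef x) (c *: b + b') = c *: fmul (lcoef x) b + fmul (lcoef x) b'.
Proof.
case: (lcoefP x) => p x0 b0 b0'; pose q := Num.min r r'.
have {}b0 : order_ge q b by apply: order_ge_le b0; rewrite /q; lia.
have {}b0' : order_ge q b' by apply: order_ge_le b0'; rewrite /q; lia.
apply/funext => n; pose K := (absz (n - p - q)%R).+1.
have nK : n - p - q < K%:Z by rewrite /K; lia.
have bb0 : order_ge q (c *: b + b').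
  by move=> i iq; rewrite -[LHS]/(c *: b i + b' i) b0// b0'// scaler0 addr0.
rewrite -[RHS]/(c *: fmul _ b n + fmul _ b' n).
rewrite (fmul_window x0 b0 nK) (fmul_window x0 b0' nK) (fmul_window x0 bb0 nK).
rewrite scaler_sumr -big_split; apply: eq_bigr => i _ /=.
rewrite -[(c *: b + b') _]/(c *: b _ + b' _).
by rewrite scalerDr !scalerA mulrC.
Qed.

Lemma fmul_map (N : lmodType F) (f : {linear M -> N}) (a : int -> F) b p r :
  order_ge p a -> order_ge r b -> fmul a (f \o b) = f \o fmul a b.
Proof.
move=> a0 b0; apply/funext => n /=; pose K := (absz (n - p - r)%R).+1.
have nK : n - p - r < K%:Z by rewrite /K; lia.
rewrite (fmul_window a0 b0 nK) (fmul_window a0 (q := r) _ nK).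
  by rewrite raddf_sum; apply: eq_bigr => i _; rewrite /= linearZ.
by move=> i ir /=; rewrite b0 ?raddf0.
Qed.

End FmulLinear.

(** * Substituting an exponential in a Laurent polynomial *)

Section ExpSums.
Variables (F : numFieldType) (W : lmodType F).
Implicit Types (x y : laurent F) (P Q : int -> W) (N : nat).

Definition supp_lt N P := forall a : int, (N <= absz a)%N -> P a = 0.

Lemma supp_lt_le N K P : (N <= K)%N -> supp_lt N P -> supp_lt K P.
Proof. by move=> NK P0 a Ka; apply: P0; apply: leq_trans Ka. Qed.

Lemma fsum_supp_lt N (c : int -> F) P : supp_lt N P ->
  \sum_(a \in [set: int]) c a *: P a =
  \sum_(j < N + N) c (- N%:Z + j%:Z) *: P (- N%:Z + j%:Z).
Proof.
move=> P0; rewrite (fsum_window (p := - N%:Z) (N := N + N)) // => a aN.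
by rewrite P0 ?scaler0//; lia.
Qed.

(** P(e^x), for a Laurent polynomial P(z) with coefficients in W. It is meant
    for finitely supported P only. *)
Definition exp_subst P : int -> W :=
  fun i => \sum_(a \in [set: int]) expx a%:~R i *: P a.

Lemma exp_subst_order_ge P : order_ge 0 (exp_subst P).
Proof.
by move=> i i0; apply: fsbig1 => a _; rewrite (@expx_order_ge F) ?scale0r.
Qed.

Lemma fmul_exp_subst x P N i : supp_lt N P ->
  fmul (lcoef x) (exp_subst P) i =
  \sum_(a \in [set: int]) lcoef (x * lexp a%:~R) i *: P a.
Proof.
move=> P0; rewrite (fsum_supp_lt _ P0).
case: (lcoefP x) => p x0; pose K := (absz (i - p)%R).+1.
have iK : i - p - 0 < K%:Z by rewrite /K; lia.
rewrite (fmul_window x0 (@exp_subst_order_ge P) iK).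
under eq_bigr => l _ do rewrite /exp_subst (fsum_supp_lt _ P0) scaler_sumr.
rewrite exchange_big; apply: eq_bigr => j _ /=.
rewrite (smul_laurent x0 (@expx_order_ge F _) iK) scaler_suml.
by apply: eq_bigr => l _; rewrite scalerA.
Qed.

Lemma fmul_lexp_exp_subst (c : int) P N : supp_lt N P ->
  fmul (lcoef (lexp (c%:~R : F))) (exp_subst P) = exp_subst (fun a => P (a - c)).
Proof.
move=> P0; apply/funext => i; rewrite (fmul_exp_subst _ _ P0) /exp_subst.
rewrite [RHS](reindex_fsbigT (fun a => a + c)).
  by apply: eq_fsbigr => a _; rewrite addrK addrC rmorphD -lexpD.
by exists (fun a => a - c) => a; rewrite ?addrK ?subrK.
Qed.

Lemma exp_subst_linear (c : F) P Q N K : supp_lt N P -> supp_lt K Q ->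
  exp_subst (fun a => c *: P a + Q a) = c *: exp_subst P + exp_subst Q.
Proof.
move=> P0 Q0; apply/funext => i.
rewrite -[RHS]/(c *: exp_subst P i + exp_subst Q i) /exp_subst.
have {}P0 : supp_lt (N + K) P by apply: supp_lt_le P0; lia.
have {}Q0 : supp_lt (N + K) Q by apply: supp_lt_le Q0; lia.
rewrite (fsum_supp_lt _ P0) (fsum_supp_lt _ Q0) (@fsum_supp_lt (N + K)).
  rewrite scaler_sumr -big_split; apply: eq_bigr => j _ /=.
  by rewrite scalerDr !scalerA mulrC.
by move=> a Na; rewrite P0// Q0// scaler0 addr0.
Qed.

Lemma exp_substB P Q N K : supp_lt N P -> supp_lt K Q ->
  exp_subst (fun a => P a - Q a) = exp_subst P - exp_subst Q.
Proof.
move=> P0 Q0; rewrite addrC -scaleN1r -(exp_subst_linear (- 1) Q0 P0); congr exp_subst.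
by apply/funext => a; rewrite scaleN1r addrC.
Qed.

(** Multiplication by z - 1. *)
Definition mul_zm1 P : int -> W := fun a => P (a - 1) - P a.

Lemma mul_zm1_supp_lt N P : supp_lt N P -> supp_lt N.+1 (mul_zm1 P).
Proof. by move=> P0 a Na; rewrite /mul_zm1 !P0 ?subr0//; lia. Qed.

Lemma fmul_expm1_exp_subst P N : supp_lt N P ->
  fmul (lcoef (lexpm1 F)) (exp_subst P) = exp_subst (mul_zm1 P).
Proof.
move=> P0.
rewrite /lexpm1 (fmul_lcoefD _ _ (@exp_subst_order_ge P)).
rewrite (fmul_lcoefN _ (@exp_subst_order_ge P)) fmul_lcoef1.
rewrite -[1 : F]/(1%:~R) (fmul_lexp_exp_subst _ P0) -(@exp_substB _ _ N.+1 N) //.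
by move=> a aN; apply: P0; lia.
Qed.

(** Up to factorials the coefficients of P(e^x) are the moments of the
    coefficients of P, the sums of the a^i P(a). Combining the moments with
    the coefficients of a Lagrange polynomial isolates one P(a). *)
Lemma exp_subst_mem (U : submodClosed W) P N :
  supp_lt N P -> (forall i : nat, exp_subst P i \in U) -> forall a, P a \in U.
Proof.
move=> P0 PU a; have [/P0->|aN] := leqP N (absz a); first exact: rpred0.
(* Nodes of the interpolation: the exponents that can occur in P. *)
pose x (j : 'I_(N + N)) : F := (- N%:Z + j%:Z)%:~R.
have xU (q : {poly F}) :
    \sum_(j < N + N) q.[x j] *: P (- N%:Z + j%:Z) \in U.
  under eq_bigr => j _ do rewrite horner_coef scaler_suml.
  rewrite exchange_big; apply: rpred_sum => i _ /=.
  have -> : \sum_(j < N + N) (q`_i * x j ^+ i) *: P (- N%:Z + j%:Z) =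
      (q`_i * i`!%:R) *: exp_subst P i.
    rewrite /exp_subst (fsum_supp_lt _ P0) scaler_sumr; apply: eq_bigr => j _.
    rewrite scalerA /= -mulrA; congr (_ * _ *: _).
    by rewrite mulrC divfK // pnatr_eq0 -lt0n fact_gt0.
  exact: rpredZ.
have jN : (absz (a + N%:Z)%R < N + N)%N by lia.
pose j0 := Ordinal jN; have j0E : - N%:Z + j0%:Z = a by rewrite /=; lia.
have := xU (\prod_(j | j != j0) ('X - (x j)%:P)).
rewrite (bigD1 j0) //= [X in _ + X]big1 ?addr0 => [|j jj0]; last first.
  rewrite horner_prod (bigD1 j) //= hornerXsubC subrr mul0r scale0r //.
set q := \prod_(j | _) _.
rewrite (_ : - N%:Z + _ = a) // => /(rpredZ q.[x j0]^-1).
rewrite scalerA mulVf ?scale1r // /q horner_prod; apply/prodf_neq0 => j jj0.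
rewrite hornerXsubC subr_eq0 eqr_int; apply: contraNneq jj0 => /addrI ej.
by apply/eqP/val_inj; case: ej.
Qed.

Lemma exp_subst_inj P Q N K :
  supp_lt N P -> supp_lt K Q -> exp_subst P = exp_subst Q -> P = Q.
Proof.
move=> P0 Q0 PQ; apply/funext => a; apply/eqP; rewrite -subr_eq0; apply/eqP.
apply: lspan_set0; apply: (@exp_subst_mem (lspan set0) (fun a => P a - Q a) (N + K)).
  by move=> b bNK; rewrite P0 ?Q0 ?subr0//; lia.
by move=> i; rewrite (exp_substB P0 Q0) PQ subrr rpred0.
Qed.

End ExpSums.

(** * The substitution of -x for x *)

Section Flip.
Variables (F : numFieldType) (W : lmodType F).
Implicit Types (x y : laurent F) (b P : int -> W).

Definition flip b : int -> W := fun i => ((- 1) ^ i : F) *: b i.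

Lemma signzD (i j : int) : (- 1) ^ (i + j) = (- 1) ^ i * (- 1) ^ j :> F.
Proof. by rewrite expfzDr// oppr_eq0 oner_eq0. Qed.

Lemma signzM (i : int) : (- 1) ^ i * (- 1) ^ i = 1 :> F.
Proof. by rewrite -expfzMl mulrNN mulr1 exp1rz. Qed.

Fact lflip_subproof x : (fun i => (- 1) ^ i * lcoef x i) \in @is_laurent F.
Proof.
case: (lcoefP x) => p x0; apply/asboolP; exists p => i ip.
by rewrite x0 ?mulr0.
Qed.
Definition lflip x := Laurent (lflip_subproof x).

Lemma flip_order_ge b r : order_ge r b -> order_ge r (flip b).
Proof. by move=> b0 i ir; rewrite /flip b0 ?scaler0. Qed.

Lemma lflipK : involutive lflip.
Proof.
by move=> x; apply: lcoef_inj; apply/funext => i /=; rewrite mulrA signzM mul1r.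
Qed.

Lemma fmul_flip x b r : order_ge r b ->
  fmul (lcoef (lflip x)) (flip b) = flip (fmul (lcoef x) b).
Proof.
case: (lcoefP x) => p x0 b0; apply/funext => n.
have fx0 : order_ge p (lcoef (lflip x)) by move=> i ip /=; rewrite x0 ?mulr0.
pose N := (absz (n - p - r)%R).+1; have nN : n - p - r < N%:Z by rewrite /N; lia.
rewrite (fmul_window fx0 (flip_order_ge b0) nN) /flip (fmul_window x0 b0 nN).
rewrite scaler_sumr; apply: eq_bigr => i _ /=.
rewrite !scalerA mulrAC -signzD; congr ((- 1) ^ _ * _ *: _); lia.
Qed.

End Flip.

Section FlipExp.
Variable F : numFieldType.
Implicit Types (x y : laurent F).

Lemma lflipM x y : lflip (x * y) = lflip x * lflip y.
Proof.
apply: lcoef_inj; rewrite lcoefM; case: (lcoefP y) => r y0.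
by rewrite /smul (fmul_flip x (b := lcoef y : int -> F^o) y0).
Qed.

Lemma expxN (c : F) (i : int) : expx (- c) i = (- 1) ^ i * expx c i.
Proof.
case: i => [n|n]; last by rewrite mulr0.
by rewrite /expx /= exprNn mulrA.
Qed.

Lemma lflip1 : lflip 1 = 1 :> laurent F.
Proof.
apply: lcoef_inj; apply/funext => i; rewrite /= /xmon.
by case: eqP => [->|_]; rewrite ?mulr0 ?expr0z ?mul1r.
Qed.

Lemma lflip_expm1 : lflip (lexpm1 F) = - (lexp (- 1) * lexpm1 F).
Proof.
rewrite /lexpm1 mulrBr -lexpD addNr lexp0 mulr1 opprB.
apply: lcoef_inj; apply/funext => i.
rewrite -[LHS]/((- 1) ^ i * (expx 1 i - xmon 0 i)) mulrBr -expxN.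
by congr (_ - _); rewrite -[RHS]/(lcoef 1 i) -lflip1.
Qed.

Lemma lflip_expm1X k :
  lflip (lexpm1 F ^+ k) = (- 1) ^+ k * (lexp (- k%:R) * lexpm1 F ^+ k).
Proof.
elim: k => [|k IH]; first by rewrite !expr0 lflip1 oppr0 lexp0 !mulr1.
rewrite exprS lflipM IH lflip_expm1 -[in RHS]natr1 opprD lexpD !exprS.
by move: (lexp _) (lexp _) (lexpm1 F ^+ k) (lexpm1 F) => a b c e; ring.
Qed.

Variable W : lmodType F.
Implicit Types (b P : int -> W).

Lemma fmul_sign k x b r : order_ge r b ->
  fmul (lcoef ((- 1) ^+ k * x)) b = (- 1) ^+ k *: fmul (lcoef x) b.
Proof.
move=> b0; elim: k => [|k IH]; first by rewrite mul1r scale1r.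
by rewrite !exprS -mulrA !mulN1r (fmul_lcoefN _ b0) IH scaleNr.
Qed.

Lemma flip_exp_subst P N : supp_lt N P ->
  flip (exp_subst P) = exp_subst (fun a => P (- a)).
Proof.
move=> P0; apply/funext => i; rewrite /exp_subst.
rewrite [RHS](reindex_fsbigT (fun a : int => - a)); last first.
  by exists (fun a : int => - a) => a; rewrite opprK.
under [RHS]eq_fsbigr => a _ do rewrite opprK rmorphN expxN.
rewrite (fsum_supp_lt _ P0) /flip (fsum_supp_lt _ P0) scaler_sumr.
by apply: eq_bigr => j _; rewrite scalerA.
Qed.

Lemma supp_lt_shift N P (c : int) :
  supp_lt N P -> supp_lt (N + absz c) (fun a => P (a - c)).
Proof. by move=> P0 a aN; apply: P0; lia. Qed.

(** As e^(-x) - 1 = - e^(-x) (e^x - 1), passing from x to -x turns the factor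
    (e^x - 1)^k into itself up to a sign and a shift by k. This shift is what
    makes the lower bound on the powers independent of k. *)
Lemma fmul_expm1_flip k b P N r : order_ge r b -> supp_lt N P ->
  fmul (lcoef (lexpm1 F ^+ k)) b = exp_subst P ->
  fmul (lcoef (lexpm1 F ^+ k)) (flip b) = (- 1) ^+ k *: exp_subst (fun a => P (k%:Z - a)).
Proof.
move=> b0 P0 bP; rewrite -[lexpm1 F ^+ k]lflipK (fmul_flip _ b0) lflip_expm1X.
rewrite (fmul_sign _ _ b0) (fmul_lcoefM _ _ b0) bP -[- k%:R]/(- k%:~R) -rmorphN.
rewrite (fmul_lexp_exp_subst _ P0).
transitivity ((- 1) ^+ k *: flip (exp_subst (fun a => P (a - - k%:Z)))).
  by apply/funext => i; rewrite /flip -[RHS]/(_ *: (_ *: _)) scalerA mulrC -scalerA.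
rewrite (flip_exp_subst (supp_lt_shift (c := - k%:Z) P0)); congr (_ *: exp_subst _).
by apply/funext => a; congr P; lia.
Qed.

End FlipExp.

(** * Associativity at a fixed total degree *)

Section Differences.
Variables (F : numFieldType) (W : lmodType F).

Section TwoMonomials.
Variables (G : zmodType) (c1 c2 : G).

Lemma smul_xmonB (b : G -> F) g :
  smul (xmon c1 \- xmon c2) b g = b (g - c1) - b (g - c2).
Proof.
rewrite -(smul_xmon c1) -(smul_xmon c2) !smul_sum.
pose A := [fset c1; c2]%fset.
have out h : h \notin A -> (xmon c1 h = 0 :> F) * (xmon c2 h = 0 :> F).
  by rewrite !inE negb_or /xmon => /andP[/negPf-> /negPf->].
rewrite !(fsbigTE A) => [|h /out xh|h /out xh|h /out xh]; rewrite /= ?xh ?subrr ?mul0r //.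
by rewrite -sumrB; apply: eq_bigr => h _; rewrite mulrBl.
Qed.

Lemma spow_xmonB_supp k :
  exists S : {fset G}, forall g, g \notin S ->
    spow (xmon c1 \- xmon c2) k g = 0 :> F.
Proof.
elim: k => [|k [S S0]].
  by exists [fset (0 : G)]%fset => g; rewrite inE /spow /= /xmon => /negPf->.
exists ([fset (s + c1)%R | s in S] `|` [fset (s + c2)%R | s in S])%fset => g.
rewrite inE negb_or => /andP[g1 g2]; rewrite /spow iterS smul_xmonB -/(spow _ k).
rewrite !S0 ?subrr//.
  by apply: contra g2 => gS; apply/imfsetP; exists (g - c2); rewrite ?subrK.
by apply: contra g1 => gS; apply/imfsetP; exists (g - c1); rewrite ?subrK.
Qed.

(** Multiplying by a difference of monomials is a difference of two shifts, so
    the powers of x1 - x2 and of x1/x2 - 1 act as iterated difference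
    operators. *)
Lemma fmul_spow_xmonB k (A : G -> W) :
  fmul (spow (xmon c1 \- xmon c2) k) A =
  iter k (fun B g => B (g - c1) - B (g - c2)) A.
Proof.
elim: k => [|k IH].
  apply/funext => g; rewrite /= /fmul (fsbigTE [fset (0 : G)]%fset) => [|h].
    by rewrite big_seq_fset1 /xmon eqxx scale1r subr0.
  by rewrite inE /xmon => /negPf->; rewrite scale0r.
rewrite iterS -IH; apply/funext => g; rewrite /spow iterS -/(spow _ k).
have [S S0] := spow_xmonB_supp k; set b := spow _ k in S0 *.
have shift c : fmul b A (g - c) = \sum_(h \in [set: G]) b (h - c) *: A (g - h).
  rewrite /fmul (reindex_fsbigT (fun h => h - c)).
    by apply: eq_fsbigr => h _; congr (_ *: A _); rewrite opprB addrA subrK.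
  by exists (fun h => h + c) => h; rewrite ?addrK ?subrK.
rewrite !shift /fmul.
pose T := ([fset (s + c1)%R | s in S] `|` [fset (s + c2)%R | s in S])%fset.
have T0 h : h \notin T -> (b (h - c1) = 0) * (b (h - c2) = 0).
  rewrite inE negb_or => /andP[h1 h2]; rewrite !S0//.
    by apply: contra h2 => hS; apply/imfsetP; exists (h - c2); rewrite ?subrK.
  by apply: contra h1 => hS; apply/imfsetP; exists (h - c1); rewrite ?subrK.
rewrite !(fsbigTE T) => [|h /T0 bh|h /T0 bh|h /T0 bh];
  rewrite ?smul_xmonB ?bh ?subrr ?scale0r //.
by rewrite -sumrB; apply: eq_bigr => h _; rewrite smul_xmonB scalerBl.
Qed.

End TwoMonomials.

(** The factor x1/x2 - 1 has degree 0, so it preserves the total degree d and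
    acts on that part as z - 1. *)
Lemma fmul_x1_div_x2_sub_1 k (A : int * int -> W) (a d : int) :
  fmul (spow x1_div_x2_sub_1 k) A (a, d - a) =
  iter k (@mul_zm1 F W) (fun a => A (a, d - a)) a.
Proof.
rewrite /x1_div_x2_sub_1 fmul_spow_xmonB; elim: k a => [|k IH] a //.
rewrite !iterS [RHS]/mul_zm1 -!IH /=; congr (_ - _).
  by congr (iter _ _ _ (_, _)); rewrite /=; lia.
by rewrite subr0.
Qed.

(** (x1 - x2)^k = x2^k (x1/x2 - 1)^k. *)
Lemma fmul_x1_sub_x2 k (A : int * int -> W) (a b : int) :
  fmul (spow x1_sub_x2 k) A (a, b) =
  fmul (spow x1_div_x2_sub_1 k) A (a, b - k%:Z).
Proof.
rewrite /x1_div_x2_sub_1 /x1_sub_x2 !fmul_spow_xmonB.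
elim: k a b => [|k IH] a b; first by rewrite subr0.
rewrite !iterS /= -![((a, b) - _)]/(_, _) !IH; congr (_ - _).
  by congr (iter _ _ _ (_, _)); rewrite /=; lia.
by congr (iter _ _ _ (_, _)); rewrite /=; lia.
Qed.

(** Division by z - 1 in series truncated from above: f(a - 1) is f(a) plus
    the coefficient of (z - 1) f(z) at a. *)
Lemma mul_zm1_mem (U : submodClosed W) (f : int -> W) :
  (exists N : int, forall a, N <= a -> f a = 0) ->
  (forall a, mul_zm1 f a \in U) -> forall a, f a \in U.
Proof.
move=> [N f0] dU a.
suff fU (m : nat) : f (N - m%:Z) \in U.
  have [/f0->|aN] := leP N a; first exact: rpred0.
  by have -> : a = N - (absz (N - a)%R)%:Z by lia.
elim: m => [|m IH]; first by rewrite f0 ?rpred0// subr0.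
have -> : f (N - m.+1%:Z) = mul_zm1 f (N - m%:Z) + f (N - m%:Z).
  by rewrite /mul_zm1 subrK; congr f; lia.
exact: rpredD.
Qed.

Lemma iter_mul_zm1_mem (U : submodClosed W) k (f : int -> W) :
  (exists N : int, forall a, N <= a -> f a = 0) ->
  (forall a, iter k (@mul_zm1 F W) f a \in U) -> forall a, f a \in U.
Proof.
elim: k f => [|k IH] f // [N f0]; rewrite iterSr => dU.
apply: mul_zm1_mem; first by exists N.
apply: IH dU; exists (N + 1) => a aN.
by rewrite /mul_zm1 !f0 ?subr0//; lia.
Qed.

End Differences.

Section Modes.
Variables (F : numFieldType) (V : wqva F) (W : phi_module V).

HB.instance Definition _ v m :=
  GRing.isLinear.Build F W W *:%R (phimod_op v m) (phimod_linearr v m).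
Definition mode_of m w : V -> W := fun v => phimod_op v m w.
HB.instance Definition _ m w :=
  GRing.isLinear.Build F V W *:%R (mode_of m w) (phimod_linearl m w).

(** The part of total degree d of Y_W(u,x1) Y_W(v,x2) w, as a series in
    z = x1/x2. *)
Definition prod_ser (u v : V) (d : int) (w : W) : int -> W :=
  fun a => phimod_op u (- a) (phimod_op v (a - d) w).

(** The coefficient of x2^d in Y_W(Y(u,x)v,x2) w. *)
Definition vertex_ser (u v : V) (d : int) (w : W) : int -> W :=
  fun l => phimod_op (Yser (@vop F V) u v l) (- d) w.

(** The associativity axiom restricted to total degree d, for every d. *)
Definition assoc_at k (u v : V) := forall d w,
  (exists N, supp_lt N (iter k (@mul_zm1 F W) (prod_ser u v d w))) /\
  fmul (lcoef (lexpm1 F ^+ k)) (vertex_ser u v d w) =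
  exp_subst (iter k (@mul_zm1 F W) (prod_ser u v d w)).

Lemma Yser_order_ge (u v : V) : exists r, order_ge r (Yser (@vop F V) u v).
Proof.
by have [N uv] := vop_trunc u v; exists (- N) => i iN; apply: uv; lia.
Qed.

Lemma vertex_ser_order_ge u v d w : exists r, order_ge r (vertex_ser u v d w).
Proof.
have [r r0] := Yser_order_ge u v; exists r => i ir.
by rewrite /vertex_ser r0// -/(mode_of _ _ _) raddf0.
Qed.

Lemma ex_assoc u v : exists k, assoc_at k u v.
Proof.
have [k [uvL uvE]] := @phimod_assoc F V W u v; exists k => d w.
have AE : (fun a => YWYW (@phimod_op F V W) u v w (a, d - a)) = prod_ser u v d w.
  by apply/funext => a; rewrite /YWYW /= opprB.
have iE a : iter k (@mul_zm1 F W) (prod_ser u v d w) a =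
    fmul (spow x1_div_x2_sub_1 k) (YWYW (@phimod_op F V W) u v w) (a, d - a).
  by rewrite fmul_x1_div_x2_sub_1 AE.
split.
  have [N N0] := uvL w; exists (absz N + absz d + k + 1)%N => a aN; rewrite iE.
  have := N0 a (d - a + k%:Z); rewrite fmul_x1_sub_x2 addrK; apply.
  by apply/orP; lia.
apply/funext => i; rewrite lcoefX lcoef_expm1 uvE /subst_exp /exp_subst.
by apply: eq_fsbigr => a _; rewrite iE.
Qed.

(** Raising the exponent allows a common one for finitely many pairs. *)
Lemma assoc_at_le k l u v : (k <= l)%N -> assoc_at k u v -> assoc_at l u v.
Proof.
move=> /subnK<- kA; elim: (l - k)%N => [|m IH] // d w.
have [[N N0] E] := IH d w; have [r r0] := vertex_ser_order_ge u v d w.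
split; first by exists N.+1; rewrite addSn iterS; apply: mul_zm1_supp_lt.
by rewrite addSn exprS (fmul_lcoefM _ _ r0) E (fmul_expm1_exp_subst N0).
Qed.

(** The coefficients of P = (z - 1)^k alpha lie in U because those of P(e^x)
    do, by associativity; dividing by (z - 1)^k then reaches alpha. *)
Lemma mode_mode_mem (U : submodClosed W) u v m q w :
  (forall y, phimod_op y (m + q) w \in U) ->
  phimod_op u m (phimod_op v q w) \in U.
Proof.
move=> wU; have [k kA] := ex_assoc u v.
pose d := - (m + q); have [[N N0] E] := kA d w.
have : forall a, iter k (@mul_zm1 F W) (prod_ser u v d w) a \in U.
  apply: (exp_subst_mem N0) => i; rewrite -E.
  have [p x0] := lcoefP (lexpm1 F ^+ k); have [r r0] := vertex_ser_order_ge u v d w.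
  rewrite (fmul_window (N := (absz (i%:Z - p - r)%R).+1) x0 r0); last lia.
  by apply: rpred_sum => j _; rewrite rpredZ// /vertex_ser opprK.
move=> /(iter_mul_zm1_mem _) aU.
have a0 : exists N : int, forall a, N <= a -> prod_ser u v d w a = 0.
  have [M vM] := phimod_trunc v w; exists (M + d) => a aM.
  by rewrite /prod_ser vM ?raddf0//; lia.
have := aU a0 (- m); rewrite /prod_ser opprK.
by have -> : - m - d = q by rewrite /d; lia.
Qed.

End Modes.

(** * Skew symmetry in V *)

Section Skew.
Variables (F : numFieldType) (V : wqva F).

HB.instance Definition _ (u : V) n :=
  GRing.isLinear.Build F V V *:%R (vop u n) (vop_linearr u n).

Definition vop_of n v : V -> V := fun u => vop u n v.
HB.instance Definition _ n v :=
  GRing.isLinear.Build F V V *:%R (vop_of n v) (vop_linearl n v).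

Lemma gbinom0 (n : int) : gbinom F n 0 = 1.
Proof. by rewrite /gbinom big_ord0 divr1. Qed.

(** This is the coefficient of x0^(-n-1) x1^0 x2^(-1) of the S-Jacobi identity
    applied to the vacuum. Creation kills the first term and leaves one
    summand of the second; on the right-hand side the expansion of (x1 - x0)^j
    contributes u_n v and the vectors y_(-2-j) 1. *)
Lemma skew_symmetry_mod_vac (u v : V) s (n : int) : S_jacobi (@vop F V) u v s ->
  exists (K : nat) (c : nat -> F) (y : nat -> V),
    vop u n v = - ((- 1) ^ n *: \sum_(t <- s) vop t.2 n t.1)
                + \sum_(j < K) c j *: vop (y j) (- 2 - j%:Z) vac.
Proof.
move=> /(_ vac (- n - 1, 0, - 1)).
have -> : fmul delta_012 (YY_12 (@vop F V) u v vac) (- n - 1, 0, - 1) = 0.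
  rewrite /fmul; apply: fsbig1 => -[[h0 h1] h2] _.
  rewrite /delta_012 /binsub /YY_12 /=.
  case: h2 => [j|j]; last by rewrite scale0r.
  case: ifP => _; last by rewrite scaler0.
  by rewrite [vop v _ _]vop_vacr_reg ?raddf0 ?scaler0//; lia.
have -> : fmul delta_021 (fun q => \sum_(t <- s) YY_21 (@vop F V) t.1 t.2 vac q)
    (- n - 1, 0, - 1) = (- 1) ^ n *: \sum_(t <- s) vop t.2 n t.1.
  rewrite /fmul (fsbigTE [fset (- n - 1, 0%:Z, n)]%fset) => [|[[h0 h1] h2] hn].
    rewrite big_seq_fset1 /delta_021 /binsub /=.
    have -> : - (- n - 1) - 1 = n by lia.
    rewrite addr0 eqxx gbinom0 expr0 !mulr1; congr (_ *: _).
    apply: eq_bigr => t _; rewrite /YY_21 /= subrr eqxx.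
    have -> : - (0 - 0) - 1 = - 1 :> int by lia.
    by rewrite vop_vacr_lim; congr vop; lia.
  rewrite /delta_021 /binsub /=.
  case: h1 hn => [[|j]|j] hn; last by rewrite mulr0 scale0r.
    rewrite addr0; case: eqP => [h2E|_]; last by rewrite mul0r mulr0 scale0r.
    rewrite big1 ?scaler0// => t _; rewrite /YY_21 /=.
    case: eqP => // h0E; case/negP: hn; rewrite inE; apply/eqP.
    by congr (_, _, _); lia.
  rewrite big1 ?scaler0// => t _; rewrite /YY_21 /=.
  case: eqP => // _; rewrite [vop t.1 _ _]vop_vacr_reg ?raddf0//; lia.
have [N uvN] := vop_trunc u v; 
have [K [KN K0]] : exists K : nat, N - n < K%:Z /\ (0 < K)%N.
  by exists (absz (N - n)%R).+1; split=> //; lia.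
pose h (j : nat) : int * int * int := (j%:Z, 0, - 1 - j%:Z).
rewrite sub0r => E.
have : fmul delta_201 (YY_02 (@vop F V) u v vac) (- n - 1, 0, - 1) =
    \sum_(j < K) delta_201 (h j) *: vop (vop u (n + j%:Z) v) (- 1 - j%:Z) vac.
  rewrite /fmul (fsbigTE [fset h k | k in iota 0 K]%fset) => [|[[h0 h1] h2] hK].
    rewrite big_imfset/=; last by move=> i j _ _ [].
    rewrite undup_id ?iota_uniq// -[X in iota 0 X]subn0 -/(index_iota 0 K) big_mkord.
    apply: eq_bigr => j _; congr (_ *: _); rewrite /YY_02 /=.
    by congr (vop (vop _ _ _) _ _); lia.
  rewrite /delta_201 /binsub /YY_02 /=.
  case: h0 hK => [j|j] hK; last by rewrite scale0r.
  case: ifP => [/eqP h1E|_]; last by rewrite scaler0.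
  have [jh|_] := eqVneq (h1 + j%:Z) (- h2 - 1); last by rewrite mul0r scale0r.
  have jK : (K <= j)%N.
    rewrite leqNgt; apply/negP => jK; case/negP: hK; apply/imfsetP; exists j => /=.
      by rewrite mem_iota; lia.
    by congr (_, _, _); lia.
  rewrite uvN; first by rewrite -/(vop_of _ _ _) raddf0 scaler0.
  lia.
rewrite -E; case: K K0 {KN} => // K _; rewrite big_ord_recl /h /delta_201 /binsub /=.
rewrite gbinom0 expr0 !mulr1 scale1r addr0 subr0 vop_vacr_lim.
move=> /esym/(canRL (addrK _)) ->; exists K.
exists (fun j => - delta_201 (h j.+1)), (fun j => vop u (n + j.+1%:Z) v).
congr (_ + _); rewrite -sumrN; apply: eq_bigr => j _; rewrite scaleNr.
by congr (- (_ *: vop _ _ _)); rewrite /bump /=; lia.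
Qed.
End Skew.

(** * The lowest power at a vector of Omega *)

Section LowestPower.
Variables (F : numFieldType) (V : wqva F) (W : phi_module V).

Lemma fmul_expm1X_exp_subst k (P : int -> W) N : supp_lt N P ->
  fmul (lcoef (lexpm1 F ^+ k)) (exp_subst P) = exp_subst (iter k (@mul_zm1 F W) P) /\
  supp_lt (k + N) (iter k (@mul_zm1 F W) P).
Proof.
move=> P0; elim: k => [|k [IH PN]]; first by rewrite fmul_lcoef1.
rewrite exprS (fmul_lcoefM _ _ (@exp_subst_order_ge F W P)) IH (fmul_expm1_exp_subst PN).
by split=> //; apply: mul_zm1_supp_lt.
Qed.

Lemma fmul_expm1VX k (b : int -> W) r : order_ge r b ->
  fmul (lcoef (lexpm1_inv F ^+ k)) (fmul (lcoef (lexpm1 F ^+ k)) b) = b.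
Proof.
move=> b0; rewrite -(fmul_lcoefM _ _ b0) -exprMn mulrC lexpm1K expr1n.
exact: fmul_lcoef1.
Qed.

(** Y_W(Y(y,x)1,x2) = Y_W(y,x2 e^x), whose constant term in x2 does not depend
    on x. At j = 0 this says that D V acts by zero. *)
Lemma zero_mode_vac_coef (y : V) (j : nat) (w : W) :
  phimod_op (vop y (- 2 - j%:Z) vac) 0 w = 0.
Proof.
have [k kA] := ex_assoc W y vac; have [_ E] := kA 0 w.
pose P := prod_ser y vac 0 w.
have P0 : supp_lt 1 P.
  move=> a a1; rewrite /P /prod_ser phimod_vac subr0.
  by case: eqP; [lia | rewrite raddf0].
(* The vacuum makes alpha itself a Laurent polynomial, so (e^x - 1)^k cancels. *)
rewrite -(fmul_expm1X_exp_subst k P0).1 in E.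
have [r r0] := vertex_ser_order_ge y vac 0 w.
have := fmul_expm1VX k r0; rewrite E (fmul_expm1VX k (@exp_subst_order_ge F W P)).
move=> /(congr1 (fun f => f (j%:Z + 1))).
rewrite /vertex_ser /Yser oppr0 /exp_subst (fsum_supp_lt _ P0) big_ord_recr big_ord1 /=.
rewrite P0 // scaler0 add0r.
rewrite addNr mulr0z addn1 expr0n mul0r scale0r => /esym.
by have -> : - (j%:Z + 1) - 1 = - 2 - j%:Z :> int by lia.
Qed.

Lemma vertex_ser_skew (u v : V) s (w : W) : S_jacobi (@vop F V) u v s ->
  vertex_ser u v 0 w = \sum_(t <- s) flip (vertex_ser t.2 t.1 0 w).
Proof.
move=> uvs; apply/funext => l; rewrite fct_sumE /vertex_ser /Yser oppr0.
have [K [c [y ->]]] := skew_symmetry_mod_vac (- l - 1) uvs.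
rewrite -/(mode_of 0 w _) linearD linearN linearZ_LR raddf_sum [X in _ + X = _]raddf_sum.
rewrite [X in _ + X = _]big1 ?addr0 => [|j _]; last first.
  rewrite -[LHS]/(mode_of 0 w (c j *: _)) linearZ_LR /= /mode_of.
  by rewrite zero_mode_vac_coef scaler0.
rewrite /= scaler_sumr -sumrN; apply: eq_bigr => t _.
rewrite /flip -scaleNr; congr (_ *: _).
rewrite signzD -[(- 1) ^ (- 1)]/((- 1)^-1) invrN1 mulrN1 opprK.
apply: (mulIf (x := (- 1) ^ l)); rewrite ?expfz_neq0 ?oppr_eq0 ?oner_eq0//.
by rewrite signzM -signzD addNr.
Qed.

Lemma iter_mul_zm1_above (P : int -> W) (m : int) k :
  (forall a, m < a -> P a = 0) ->
  forall a, m + k%:Z < a -> iter k (@mul_zm1 F W) P a = 0.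
Proof.
move=> P0; elim: k => [|k IH] a ma; first by apply: P0; lia.
by rewrite iterS /mul_zm1 !IH ?subr0//; lia.
Qed.

Lemma ex_common_assoc (s : seq (V * V)) :
  exists k, forall t, t \in s -> assoc_at W k t.1 t.2.
Proof.
elim: s => [|t s [k ks]]; first by exists 0%N.
have [l lt] := ex_assoc W t.1 t.2; exists (maxn k l) => r.
rewrite inE => /orP[/eqP->|/ks]; first exact: assoc_at_le (leq_maxr _ _) lt.
exact: assoc_at_le (leq_maxl _ _).
Qed.

(** By skew symmetry, P(z) is up to sign the sum of the z^k P_i(1/z), where
    P_i is attached to the pair (v^(i), u^(i)). As w is in Omega_n, P_i has no
    power above n + k, so P has none below -n. *)
Lemma ex_assoc_Omega (n : nat) (u v : V) w : w \in Omega W n ->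
  exists k, assoc_at W k u v /\
    forall a : int, a < - n%:Z -> iter k (@mul_zm1 F W) (prod_ser u v 0 w) a = 0.
Proof.
move=> /asboolP w0; have [s uvs] := vop_jacobi u v.
(* One exponent k for the pair (u, v) and all the pairs given by the S-map. *)
have [k ks] := ex_common_assoc ((u, v) :: [seq (t.2, t.1) | t <- s]).
have kuv : assoc_at W k u v by apply: (ks (u, v)); rewrite mem_head.
exists k; split=> //; have [[N P0] E] := kuv 0 w.
suff [Q [K [Q0 Qn QE]]] : exists Q K, [/\ supp_lt K Q,
    forall a : int, a < - n%:Z -> Q a = 0 &
    fmul (lcoef (lexpm1 F ^+ k)) (vertex_ser u v 0 w) = exp_subst Q].
  by rewrite (exp_subst_inj P0 Q0 _) // -E.
rewrite (vertex_ser_skew w uvs).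
have {ks}: forall t, t \in s -> assoc_at W k t.2 t.1.
  by move=> t ts; apply: (ks (t.2, t.1)); rewrite inE map_f ?orbT.
suff sQ : (forall t, t \in s -> assoc_at W k t.2 t.1) ->
  exists Q K r, [/\ supp_lt K Q, forall a : int, a < - n%:Z -> Q a = 0,
    order_ge r (\sum_(t <- s) flip (vertex_ser t.2 t.1 0 w)) &
    fmul (lcoef (lexpm1 F ^+ k))
      (\sum_(t <- s) flip (vertex_ser t.2 t.1 0 w)) = exp_subst Q].
  by move/sQ=> [Q [K [r [Q0 Qn _ QE]]]]; exists Q, K.
elim: s {uvs} => [|t s IH] ks.
  have e0 : exp_subst (fun _ => 0) = 0 :> (int -> W).
    by apply/funext => i; apply: fsbig1 => a _; rewrite scaler0.
  exists (fun _ => 0), 0%N, 0; split=> //; first by rewrite big_nil.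
  rewrite big_nil e0; apply/funext => i; rewrite /fmul fsbig1// => l _.
  by rewrite -[(0 : int -> W) _]/(0 : W) scaler0.
have [Q [K [r [Q0 Qn sr QE]]]] := IH (fun t' t's => ks t' (mem_behead (s := t :: s) t's)).
have [[M R0] RE] := ks t (mem_head _ _) 0 w.
have [r' r'0] := vertex_ser_order_ge t.2 t.1 0 w.
set R := iter k _ _ in R0 RE.
have Rn a : n%:Z + k%:Z < a -> R a = 0.
  apply: iter_mul_zm1_above => {}a na; rewrite /prod_ser subr0.
  by rewrite [phimod_op t.1 _ _]w0 ?raddf0//; lia.
have R1 : supp_lt (M + k) (fun a => R (k%:Z - a)) by move=> a aM; apply: R0; lia.
exists (fun a => (- 1) ^+ k *: R (k%:Z - a) + Q a), (M + k + K)%N, (Num.min r r').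
split.
- by move=> a aM; rewrite R1 ?Q0 ?scaler0 ?addr0//; lia.
- by move=> a an; rewrite Qn// Rn ?scaler0 ?addr0//; lia.
- move=> i ir; have [ir1 ir2] : i < r /\ i < r' by lia.
  by rewrite big_cons -[LHS]/(_ i + _ i) (sr _ ir1) (flip_order_ge r'0 ir2) addr0.
rewrite big_cons (exp_subst_linear _ R1 Q0) -QE.
rewrite -(fmul_expm1_flip r'0 R0 RE) -[X in _ = X + _]scale1r.
by rewrite -(fmul_linear _ _ (flip_order_ge r'0) sr) scale1r.
Qed.

End LowestPower.

(** * Binomial identities *)

Section Binomials.
Variable F : numFieldType.

Lemma gbinom_opp (n i : nat) :
  gbinom F (- n%:Z - 1) i = (- 1) ^+ i * 'C(n + i, i)%:R.
Proof.
rewrite /gbinom; apply: (mulIf (x := i`!%:R)); first by rewrite pnatr_eq0 -lt0n fact_gt0.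
rewrite divfK ?pnatr_eq0 -?lt0n ?fact_gt0// -mulrA -natrM.
elim: i => [|i IH]; first by rewrite big_ord0 bin0 mul1r.
rewrite big_ord_recr /= IH factS mulnA [in RHS](mulnC 'C(_, _)) addnS -mul_bin_diag.
by rewrite exprS rmorphB rmorphN /= -mulnA !natrM -addn1 !natrD; ring.
Qed.

(** Both sides count the chains of an i-subset in an (n + i)-subset of a set
    with n + e elements. *)
Lemma bin_trinomial (n e i : nat) :
  ('C(n + i, i) * 'C(n + e, i + n) = 'C(n + e, n) * 'C(e, i))%N.
Proof.
have [ie|ei] := leqP i e; last first.
  rewrite [X in (_ * X)%N]bin_small ?[X in (_ = _ * X)%N]bin_small ?muln0//; lia.
apply/eqP; rewrite -(eqn_pmul2r (fact_gt0 (e - i))).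
rewrite -(eqn_pmul2r (fact_gt0 i)) -(eqn_pmul2r (fact_gt0 n)).
have := @bin_fact (n + i) i (leq_addl _ _); rewrite addnK => E1.
have := @bin_fact (n + e) (i + n) ltac:(lia).
rewrite (_ : n + e - (i + n) = e - i)%N ?[(i + n)%N]addnC; last lia.
rewrite -E1 => E2.
have := @bin_fact (n + e) n (leq_addr _ _); rewrite addKn -(bin_fact ie) => E3.
apply/eqP; transitivity ((n + e)`!)%N; [rewrite -E2 | rewrite -E3]; nia.
Qed.

(** The sum over i truncates the expansion z^(-n-1) = sum_i C(-n-1,i)
    (z - 1)^(-n-1-i) at a point where the omitted terms only affect b > 2n.
    Concretely it is C(b,n) times the alternating sum of the binomial
    coefficients C(b-n,i), which is (1 - 1)^(b-n). *)
Lemma sum_gbinom_bin (n b : nat) : (b <= n + n)%N ->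
  \sum_(i < n.+1) gbinom F (- n%:Z - 1) i * 'C(b, i + n)%:R = (b == n)%:R.
Proof.
move=> bn; have [nb|bn'] := leqP n b; last first.
  by rewrite big1 ?ltn_eqF// => i _; rewrite bin_small ?mulr0//; lia.
have [e eb] : exists e, b = (n + e)%N by exists (b - n)%N; lia.
have en : (e <= n)%N by lia.
rewrite eb; under eq_bigr => i _.
  rewrite gbinom_opp -mulrA -natrM bin_trinomial natrM mulrCA; over.
rewrite -mulr_sumr.
have -> : \sum_(i < n.+1) (- 1) ^+ i * 'C(e, i)%:R = (e == 0%N)%:R :> F.
  rewrite -[RHS](expr0n) -[X in X ^+ _](subrr 1) exprBn.
  rewrite (big_ord_widen n.+1
    (fun i => (- 1) ^+ i * 1 ^+ (e - i) * 1 ^+ i *+ 'C(e, i))) //.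
  rewrite [RHS]big_mkcond; apply: eq_bigr => i _ /=; case: ltnP => ie.
    by rewrite !expr1n !mulr1 mulr_natr.
  by rewrite bin_small ?mulr0.
have -> : (n + e == n)%N = (e == 0)%N by rewrite -[X in _ == X]addn0 eqn_add2l.
case: eqP => [->|_]; last exact: mulr0.
by rewrite addn0 binn mulr1.
Qed.

End Binomials.

(** * Zero modes of the two residue products *)

Section ZeroModeResidues.
Variables (F : numFieldType) (V : wqva F) (W : phi_module V).

(** The sum weighted by C(b,m) extracts the coefficient of (z - 1)^m from the
    polynomial part of z^(-c) f(z), which becomes that of (z - 1)^(m+k) after
    multiplication by (z - 1)^k. The series f need not be bounded below: for
    k > 0 the summation by parts has no boundary term, because C(0,m+k) = 0.
    *)
Lemma sum_bin_iter_mul_zm1 (f : int -> W) (c : int) (B m k : nat) :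
  (forall a, c + B%:Z <= a -> f a = 0) ->
  \sum_(b < B + k) 'C(b, m + k)%:R *: iter k (@mul_zm1 F W) f (c + b%:Z) =
  \sum_(b < B) 'C(b, m)%:R *: f (c + b%:Z).
Proof.
move=> f0; elim: k => [|k IH]; first by rewrite !addn0.
rewrite -IH !addnS iterS {IH}.
have h0 : iter k (@mul_zm1 F W) f (c + (B + k)%N%:Z) = 0.
  rewrite (@iter_mul_zm1_above _ _ _ _ (c + B%:Z - 1)) // => [a ca|]; last lia.
  by apply: f0; lia.
move: (iter k _ f) h0 => h h0; rewrite /mul_zm1.
under eq_bigr do rewrite scalerBr.
rewrite sumrB big_ord_recl bin0n scale0r add0r big_ord_recr /= h0 scaler0 addr0.
rewrite -sumrB; apply: eq_bigr => b _ /=.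
have -> : c + (bump 0 b)%:Z - 1 = c + b%:Z by rewrite /bump; lia.
by rewrite -scalerBl binS natrD addrC addKr.
Qed.

(** After insertion of the associativity identity, e^((n+1)x) (e^x - 1)^(-N-1)
    g(x) is e^((n+1)x) (e^x - 1)^(-N-1-k) P(e^x), and since P has no power
    below -n only the residues of e^((b+1)x) (e^x - 1)^(-N-1-k) with b >= 0
    occur. *)
Lemma fmul_vertex_ser_Omega (n N : nat) (u v : V) w : w \in Omega W n ->
  fmul (lcoef (lexp n.+1%:R * lexpm1_inv F ^+ N.+1)) (vertex_ser u v 0 w) (- 1) =
  \sum_(b < (n + n).+1) 'C(b, N)%:R *: prod_ser u v 0 w (- n%:Z + b%:Z).
Proof.
move=> wO; have [k [kA Pn]] := ex_assoc_Omega u v wO.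
have [[K P0] E] := kA 0 w; have [r r0] := vertex_ser_order_ge u v 0 w.
have f0 a : - n%:Z + (n + n).+1%:Z <= a -> prod_ser u v 0 w a = 0.
  move: wO => /asboolP w0 na.
  by rewrite /prod_ser subr0 [phimod_op v _ _]w0 ?raddf0//; lia.
rewrite -(sum_bin_iter_mul_zm1 N k f0).
rewrite -[in LHS](fmul_expm1VX k r0) E -(fmul_lcoefM _ _ (@exp_subst_order_ge F W _)).
rewrite -mulrA -exprD (fmul_exp_subst _ _ P0).
rewrite (fsum_window (p := - n%:Z) (N := (n + n).+1 + k)) => [|a /orP[an|na]].
- apply: eq_bigr => b _; congr (_ *: _).
  rewrite mulrAC -lexpD -(Res_lexp_expm1_inv F b (N + k)) /Res.
  congr (lcoef (lexp _ * _ ^+ _) _).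
  by rewrite -[n.+1%:R]/(n.+1%:Z%:~R) -rmorphD -[b.+1%:R]/(b.+1%:Z%:~R); congr _%:~R; lia.
- by rewrite Pn// scaler0.
- rewrite (@iter_mul_zm1_above _ _ _ _ n%:Z) ?scaler0// => [{}a {}na|]; last lia.
  by apply: f0; lia.
Qed.

Lemma zero_mode_Res x (u v : V) (w : W) :
  phimod_op (Res (fmul (lcoef x) (Yser (@vop F V) u v))) 0 w =
  fmul (lcoef x) (vertex_ser u v 0 w) (- 1).
Proof.
have [p x0] := lcoefP x; have [r r0] := Yser_order_ge u v.
transitivity (fmul (lcoef x) (mode_of 0 w \o Yser (@vop F V) u v) (- 1)).
  by rewrite (fmul_map _ x0 r0).
by [].
Qed.

(** The exponent N = 2n + 1 exceeds every b <= 2n, so all the binomial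
    coefficients vanish. *)
Lemma zero_mode_circ n (u v : V) w : w \in Omega W n ->
  phimod_op (zhu_circ n u v) 0 w = 0.
Proof.
move=> wO; rewrite /zhu_circ.
rewrite -[spow _ _]/(spow (lcoef (lexpm1_inv F)) _) -lcoefX.
rewrite -[expx _]/(lcoef (lexp n.+1%:R)) -lcoefM zero_mode_Res.
rewrite (_ : 2 * n + 2 = (n + n).+1.+1)%N; last lia.
rewrite (fmul_vertex_ser_Omega _ _ _ wO) big1 // => b _.
by rewrite bin_small ?scale0r.
Qed.

Lemma lcoef_expm1_invX_order_ge k : order_ge (- k%:Z) (lcoef (lexpm1_inv F ^+ k)).
Proof.
elim: k => [|k IH] i ik; first by rewrite lcoef1 /xmon lt_eqF.
rewrite exprS lcoefM; apply: smul_supp IH _ _; first by move=> j; apply: expm1_inv_supp.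
by lia.
Qed.

Lemma zero_mode_mul n (u v : V) w : w \in Omega W n ->
  phimod_op (zhu_mul n u v) 0 w = phimod_op u 0 (phimod_op v 0 w).
Proof.
move=> wO; rewrite /zhu_mul /Res /zhu_f.
pose x (i : nat) := lexp (n.+1%:R : F) * lexpm1_inv F ^+ (i + n + 1).
have xE (i : nat) : smul (expx n.+1%:R) (spow expm1_inv (i + n + 1)) = lcoef (x i).
  by rewrite lcoefM lcoefX.
have x0 (i : 'I_n.+1) : order_ge (- (n + n + 1)%:Z) (lcoef (x i)).
  move: (i : nat) (leq_ord i) => {}i ni.
  apply: (@order_ge_le _ _ (0 - (i + n + 1)%N%:Z)); first lia.
  by apply: smul_supp (@lcoef_expm1_invX_order_ge _); apply: expx_order_ge.
have [r r0] := Yser_order_ge u v.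
rewrite (_ : (fun j => _) =
  fun j => \sum_(i < n.+1) gbinom F (- n%:Z - 1) i * lcoef (x i) j); last first.
  by apply/funext => j; apply: eq_bigr => i _; rewrite xE.
rewrite (fmul_suml _ _ x0 r0) -/(mode_of _ _ _) linear_sum.
transitivity (\sum_(i < n.+1) \sum_(b < (n + n).+1)
    gbinom F (- n%:Z - 1) i *: ('C(b, i + n)%:R *: prod_ser u v 0 w (- n%:Z + b%:Z))).
  apply: eq_bigr => i _; rewrite linearZ_LR -scaler_sumr; congr (_ *: _).
  by rewrite -(fmul_vertex_ser_Omega _ _ _ wO) -(addn1 (i + n)); apply: zero_mode_Res.
rewrite exchange_big (bigD1 (inord n)) //= [X in _ + X]big1 ?addr0 => [|b bn].
  under eq_bigr => i _ do rewrite scalerA.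
  rewrite -scaler_suml sum_gbinom_bin ?inordK ?eqxx ?scale1r; try lia.
  by rewrite /prod_ser subr0 addNr oppr0.
under eq_bigr => i _ do rewrite scalerA.
rewrite -scaler_suml sum_gbinom_bin; last by move: (ltn_ord b); lia.
case: eqP => [bn'|_]; last by rewrite scale0r.
by case/eqP: bn; apply/val_inj; rewrite /= inordK; lia.
Qed.

End ZeroModeResidues.

(** * Modules over the Zhu algebra *)

Section ZhuModules.
Variables (F : numFieldType) (V : wqva F) (W : phi_module V) (n : nat).

Lemma zero_mode_zhu_O (x : V) (w : W) :
  w \in Omega W n -> x \in zhu_O V n -> phimod_op x 0 w = 0.
Proof.
move=> wO /lspanP[r [a [s [sO ->]]]]; rewrite -/(mode_of _ _ _) linear_sum.
apply: big1 => i _; rewrite linearZ_LR.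
suff si0 : mode_of 0 w (s i) = 0 by rewrite -[RHS](scaler0 _ (a i)) -[in RHS]si0.
rewrite /mode_of.
case: (sO i) => [[v ->]|[u [v ->]]]; last exact: zero_mode_circ.
exact: (zero_mode_vac_coef v 0 w).
Qed.

Lemma Omega_zero_mode (v : V) (w : W) :
  w \in Omega W n -> phimod_op v 0 w \in Omega W n.
Proof.
move=> /asboolP w0; apply/asboolP => u m nm; apply: lspan_set0.
by apply: mode_mode_mem => y; rewrite addr0 w0 ?rpred0.
Qed.

(** Stated for a subspace U of Omega_n, so as to cover both Omega_n and the
    lowest component of a graded module. *)
Lemma ex_zero_mode_action (U : submodClosed W) :
    (forall w, w \in U -> w \in Omega W n) ->
    (forall (v : V) w, w \in U -> phimod_op v 0 w \in U) ->
  exists act : zhu V n -> subspace_of U -> subspace_of U,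
    acts_by_zero_mode act /\ zhu_module act.
Proof.
move=> UO U0.
have rep (q : zhu V n) : {v : V | zhu_class n v = q}.
  by exists (repr (q : Quotient.quot (zmod_of (zhu_O V n)))); apply: lquot_repr.
have xU (x : subspace_of U) : subspace_val x \in U by case: x.
pose act (q : zhu V n) (x : subspace_of U) := Subspace (U0 (sval (rep q)) _ (xU x)).
have actE : acts_by_zero_mode act.
  move=> v x /=; case: (rep _) => v' /= /lquot_classP v'v.
  apply/eqP; rewrite -subr_eq0 -!/(mode_of _ _ _) -raddfB; apply/eqP.
  exact: zero_mode_zhu_O (UO _ (xU x)) v'v.
clearbody act; exists act; split=> //; split=> [x a p q|q a x y|x|u v x].
- case: (rep p) (rep q) => p' <- [q' <-].
  have -> : a *: zhu_class n p' + zhu_class n q' = zhu_class n (a *: p' + q').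
    by rewrite /zhu_class lquot_classD -lquot_classZ.
  apply: val_inj; rewrite [LHS]actE phimod_linearl.
  by rewrite -[RHS]/(a *: subspace_val _ + subspace_val _) !actE.
- case: (rep q) => q' <-; apply: val_inj; rewrite [LHS]actE.
  rewrite -[RHS]/(a *: subspace_val _ + subspace_val _) !actE.
  exact: phimod_linearr.
- by apply: val_inj; rewrite [LHS]actE phimod_vac.
by apply: val_inj; rewrite [LHS]actE [RHS]actE actE (zero_mode_mul _ _ (UO _ (xU x))).
Qed.

End ZhuModules.

(** * Graded modules *)

Section GradedModules.
Variables (F : numFieldType) (V : wqva F) (W : phi_module V).
Variable gr : nat -> submodClosed W.

(** The components are only asked to be linear subspaces given by predicates,
    because W[i] intersected with a submodule has to be allowed. *)
Lemma lspan_sum_of_components (T : nat -> {pred W}) (S : set W) w :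
    (forall i, submod_closed (T i)) -> (forall s, S s -> exists i, s \in T i) ->
  w \in lspan S -> sum_of_components T w.
Proof.
move=> Tcl ST /lspanP[r [a [s [Ss ->]]]].
have /choice[f fP] : forall j, exists i, s j \in T i by move=> j; apply: ST.
pose N := (\max_j f j)%N; have fN j : (f j < N.+1)%N by rewrite ltnS leq_bigmax.
exists N.+1, (fun i => \sum_(j | inord (f j) == i) a j *: s j); split=> [i|].
  have [T0 TD] := Tcl i.
  apply: (big_ind (fun x => x \in T i)) => // [x y xT yT|j /eqP ji].
    by rewrite -[x]scale1r TD.
  by rewrite -[_ *: _]addr0 TD// -ji inordK.
by rewrite [LHS](partition_big (fun j => inord (f j) : 'I_N.+1) predT).
Qed.

Lemma sum_of_components0 (T : nat -> {pred W}) w :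
    direct_sum_decomposition gr -> (forall i, {subset T i <= gr i}) -> 0 \in T 0%N ->
  w \in gr 0%N -> sum_of_components T w -> w \in T 0%N.
Proof.
move=> [_ dir] Tgr T0 w0 [[|N] [c [cT wE]]]; first by rewrite wE big_ord0.
suff /(_ ord0) /= : forall i, (if i == ord0 then c ord0 - w else c i) = 0.
  by move/eqP; rewrite subr_eq0 => /eqP<-; apply: (cT ord0).
apply: dir => [i|].
  case: eqP => [->|_]; last exact: Tgr (cT i).
  by rewrite -scaleN1r rpredD ?rpredZ//; apply: Tgr (cT ord0).
rewrite big_ord_recl /= wE [in X in _ - X]big_ord_recl opprD addrA subrr add0r.
by rewrite addrC subrr.
Qed.

(** By [mode_mode_mem], the span of all v_[m] x with x in S is a graded
    submodule, hence everything. Its degree 0 part comes from the v_[e] x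
    alone, which lie in T0. *)
Lemma graded_generation (e : nat) (S : set W) (T0 : submodClosed W) :
    N_grading gr -> graded_irreducible gr ->
    (forall x, S x -> x \in gr e) ->
    (exists2 x, S x & x != 0) ->
    {subset T0 <= gr 0%N} ->
    (forall (v : V) x, S x -> phimod_op v e x \in T0) ->
  {subset gr 0%N <= T0}.
Proof.
move=> [dir modes] [_ irr] Sgr [x Sx x0] T0gr ST0 w w0.
pose G : set W := [set y | exists v m x, S x /\ y = phimod_op v m x].
have Gcomp y : G y -> y = 0 \/
    exists i : nat, y \in gr i /\ (i = 0%N -> y \in T0).
  case=> v [m [z [Sz ->]]]; have := modes v m e z (Sgr z Sz).
  case E : (e%:Z - m) => [i|i] /=; last by rewrite inE => /eqP; left.
  move=> zi; right; exists i; split=> // i0.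
  have -> : m = e by lia.
  exact: ST0.
pose U : submodClosed W := lspan G.
have GU y : G y -> y \in U by apply: mem_lspan.
have [|U0|Uall] := irr U.
- split=> [v m y|y].
    move=> /lspanP[r [a [s [Gs ->]]]]; rewrite linear_sum; apply: rpred_sum => i _.
    rewrite linearZ_LR rpredZ//; have [v' [m' [z [Sz ->]]]] := Gs i.
    by apply: mode_mode_mem => y'; apply: GU; exists y', (m + m'), z.
  apply: lspan_sum_of_components => [i|s Gs].
    split=> [|a u v]; first by rewrite inE /= !rpred0.
    by rewrite !inE => /andP[u1 u2] /andP[v1 v2]; rewrite !rpredD ?rpredZ.
  have [->|[i [si _]]] := Gcomp s Gs; first by exists 0%N; rewrite inE /= !rpred0.
  by exists i; rewrite inE /= si GU.
- case/eqP: x0; apply: U0; apply: GU.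
  by exists vac, 0, x; rewrite phimod_vac.
pose T i : {pred W} := if i is 0%N then mem T0 else mem (gr i).
apply: (@sum_of_components0 T w dir) => //.
- by case=> [|i] y //; apply: T0gr.
- exact: rpred0.
apply: lspan_sum_of_components (Uall w) => [[|i]|s Gs].
- by split=> [|a u v u1 v1]; rewrite ?rpred0// rpredD ?rpredZ.
- by split=> [|a u v u1 v1]; rewrite ?rpred0// rpredD ?rpredZ.
have [->|[[|i] [si sT]]] := Gcomp s Gs; first by exists 0%N; apply: rpred0.
  by exists 0%N; apply: sT.
by exists i.+1.
Qed.

(** The vectors v_[m] c_i have distinct degrees i - m, so they vanish if their
    sum does. *)
Lemma Omega0_component (N : nat) (c : 'I_N -> W) :
    N_grading gr -> (forall i, c i \in gr i) ->
  \sum_(i < N) c i \in Omega W 0 -> forall i, c i \in Omega W 0.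
Proof.
move=> [[_ dir] modes] cgr /asboolP w0 i0; apply/asboolP => v m m1.
(* c is extended by zero to all of nat, so that the sum can be reindexed. *)
pose g (i : nat) : W := phimod_op v m (if insub i is Some j then c j else 0).
have gE (i : 'I_N) : g i = phimod_op v m (c i) by rewrite /g valK.
have gcomp i : g i \in component gr (i%:Z - m).
  rewrite /g; case: insubP => [j _ <-|_]; first exact: modes.
  by rewrite raddf0; case: (_ - m) => [k|k] /=; rewrite ?rpred0// inE.
have gsum : \sum_(0 <= i < N) g i = 0.
  have := w0 v m m1; rewrite linear_sum => E; rewrite big_mkord -[RHS]E.
  by apply: eq_bigr => i _; rewrite gE.
have [k mE] : exists k : nat, m = k%:Z by exists (absz m); lia.
have glow i : (i < k)%N -> g i = 0.
  move=> ik; have := gcomp i; case E: (i%:Z - m) => [j|j]; first by lia.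
  by rewrite inE => /eqP.
rewrite -gE; have [/glow//|ki] := ltnP i0 k.
have kN : (k <= N)%N by apply: leq_trans ki (ltnW (ltn_ord i0)).
have := gsum; rewrite (big_cat_nat (leq0n k) kN) //= big_nat.
rewrite big1 ?add0r => [|i /andP[_ /glow]//].
rewrite -[X in \sum_(X <= _ < _) _]add0n big_addn big_mkord => dsum.
have jN : (i0 - k < N - k)%N by have := ltn_ord i0; lia.
have := @dir (N - k)%N (fun j => g (j + k)%N) _ dsum (Ordinal jN); rewrite /= subnK//.
apply=> j; have := gcomp (j + k)%N.
by have -> : (j + k)%N%:Z - m = j by lia.
Qed.

Lemma Omega0_eq :
    N_grading gr -> graded_irreducible gr -> (exists w, w \in gr 0%N /\ w != 0) ->
  Omega W 0 =i gr 0%N.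
Proof.
move=> gradW irr [w1 [w1gr w1n0]] w; apply/idP/idP => [wO|w0].
  have [N [c [cgr wE]]] := gradW.1.1 w; rewrite wE; apply: rpred_sum => i _.
  have cO : c i \in Omega W 0 by apply: Omega0_component => //; rewrite -wE.
  have [i0|ipos] := posnP i; first by rewrite -i0.
  have [->|ci0] := eqVneq (c i) 0; first exact: rpred0.
  case/eqP: w1n0; apply: lspan_set0.
  apply: (@graded_generation i [set x | x = c i] (lspan set0)) w1gr => //.
  - by move=> x ->.
  - by exists (c i).
  - by move=> x /lspan_set0->; apply: rpred0.
  by move=> v x ->; move/asboolP: cO => ->; rewrite ?rpred0.
apply/asboolP => v m m1; have := gradW.2 v m 0%N w w0.
by case E: (0%N%:Z - m) => [j|j]; [lia | rewrite inE => /eqP].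
Qed.

Lemma degree0_irreducible
    (act : zhu V 0 -> subspace_of (gr 0%N) -> subspace_of (gr 0%N)) :
    N_grading gr -> graded_irreducible gr -> (exists w, w \in gr 0%N /\ w != 0) ->
  acts_by_zero_mode act -> zhu_irreducible act.
Proof.
move=> gradW irr exw actE.
split=> [|U Uact].
  have [w [w0 wn0]] := exw; exists (Subspace w0); apply: contra_neq wn0 => E.
  exact: (congr1 (@subspace_val _ _ _) E).
have [U0|] := pselect (forall x, x \in U -> x = 0); [by left | right].
have [x xU xn0] : exists2 x, x \in U & x != 0.
  apply/not_exists2P => H; apply: b => x xU.
  by have [/(_ xU)//|/negP/negPn/eqP] := H x.
pose S : set W := [set y | exists2 x, x \in U & y = subspace_val x].
have SU y : subspace_val y \in lspan S -> y \in U.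
  move=> /lspanP[r [a [s [Ss yE]]]].
  have /choice[f fP] : forall i, exists x, x \in U /\ s i = subspace_val x.
    by move=> i; have [z zU zE] := Ss i; exists z.
  rewrite (_ : y = \sum_(i < r) a i *: f i).
    by apply: rpred_sum => i _; rewrite rpredZ ?(fP i).1.
  apply: val_inj; rewrite linear_sum /= yE; apply: eq_bigr => i _.
  by rewrite (fP i).2.
move=> y; apply: SU; have Sgr z : S z -> z \in gr 0%N by case=> x' _ ->; case: x'.
apply: (@graded_generation 0 S (lspan S)) => //.
- by exists (subspace_val x); [exists x | apply: contra_neq xn0 => E; apply: val_inj].
- by move=> z; apply: lspan_sub.
- move=> v _ [z zU ->]; apply: mem_lspan.
  by exists (act (zhu_class 0 v) z); [exact: Uact | rewrite actE].
by case: y.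
Qed.

End GradedModules.

Theorem proposition2p17 (R : realType) (V : wqva (complex R)) :
  (forall (W : phi_module V) (n : nat),
     exists act : zhu V n -> subspace_of (Omega W n) -> subspace_of (Omega W n),
       acts_by_zero_mode act /\ zhu_module act)
  /\
  (forall (W : phi_module V) (gr : nat -> submodClosed W),
     N_grading gr -> graded_irreducible gr ->
     (exists w : W, w \in gr 0%N /\ w != 0) ->
     Omega W 0 =i gr 0%N /\
     exists act : zhu V 0 -> subspace_of (gr 0%N) -> subspace_of (gr 0%N),
       [/\ acts_by_zero_mode act, zhu_module act & zhu_irreducible act]).
Proof.
split=> [W n|W gr gradW irr exw].
  by apply: ex_zero_mode_action => // v w; apply: Omega_zero_mode.
have Ogr := Omega0_eq gradW irr exw; split=> //.
have [|v w w0|act [actE actM]] := @ex_zero_mode_action _ V W 0 (gr 0%N).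
- by move=> w w0; rewrite Ogr.
- by rewrite -Ogr; apply: Omega_zero_mode; rewrite Ogr.
by exists act; split=> //; apply: degree0_irreducible.
Qed.
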